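(* For each $N\in\mathbb{N}$ let $A_N$ be an $N\times N$ GOE random matrix. Then the averaged eigenvalue distribution $\mu_N:=\mathbb{E}[\mu_{A_N}]$ converges weakly, as $N\to\infty$, to the semicircle distribution $\mu_W$; that is, $\int f\,d\mu_N\to\int f\,d\mu_W$ for every bounded continuous function $f:\mathbb{R}\to\mathbb{C}$.
   Context: An $N\times N$ GOE random matrix is a random real symmetric matrix $A_N=(x_{ij})_{i,j=1}^N$, $x_{ij}=x_{ji}$, distributed according to the probability measure $$d\mathbb{P}_N(A)=c_N\exp\left(-\tfrac N4\operatorname{Tr}(A^2)\right)\prod_{i\le j}dx_{ij}$$ on the space of real symmetric $N\times N$ matrices, with normalization constant $c_N$. Equivalently, $\{x_{ij}\mid i\le j\}$ are independent centered real Gaussians with variance $1/N$ for $i\ne j$ and $2/N$ for $i=j$. For a selfadjoint matrix $A$ with eigenvalues $\lambda_1,\dots,\lambda_N$ (counted with multiplicity), $\mu_A:=\frac1N(\delta_{\lambda_1}+\cdots+\delta_{\lambda_N})$ is its eigenvalue distribution, and $\mathbb{E}[\mu_{A_N}]$ is the probability measure $B\mapsto\mathbb{E}[\mu_{A_N}(B)]$. The semicircle distribution $\mu_W$ is the probability measure on $[-2,2]$ with density $\frac1{2\pi}\sqrt{4-x^2}$. *)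

(* Defs.v *)
From HB Require Import structures.
From mathcomp Require Import all_boot all_order all_algebra spectral.
From mathcomp Require Import polyrcf complex.
From mathcomp Require Import all_classical all_reals all_analysis.
From mathcomp Require Import measurable_realfun ring lra.

Set Implicit Arguments.
Unset Strict Implicit.
Unset Printing Implicit Defensive.

Import Order.TTheory GRing.Theory Num.Theory.
Import numFieldNormedType.Exports.

Local Open Scope classical_set_scope.
Local Open Scope ring_scope.

(* Real eigenvalues listed with their multiplicity as roots of the
   characteristic polynomial; for a symmetric matrix of size n + 1 there are
   n + 1 of them (size_eigenvalues_symmx). *)
Definition eigenvalues (R : rcfType) n (A : 'M[R]_n) : seq R :=
  flatten [seq nseq (mup x (char_poly A)) x | x <- rootsR (char_poly A)].

Lemma perm_eigenvalues (R : rcfType) n (A : 'M[R]_n) (s : seq R) :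
  char_poly A = \prod_(x <- s) ('X - x%:P) -> perm_eq (eigenvalues A) s.
Proof.
move=> As; have p0 : char_poly A != 0 by exact/monic_neq0/char_poly_monic.
apply: perm_trans (perm_count_undup s).
rewrite /eigenvalues (eq_map (_ : _ =1 fun x => nseq (count_mem x s) x)).
  apply/perm_flatten/perm_map/uniq_perm; rewrite ?uniq_roots ?undup_uniq//.
  by move=> x; rewrite mem_undup -roots_on_rootsR// in_itv/= As root_prod_XsubC.
by move=> x; rewrite As mu_prod_XsubC.
Qed.

Lemma char_poly_conj (F : fieldType) n (P B : 'M[F]_n) : P \in unitmx ->
  char_poly (invmx P *m B *m P) = char_poly B.
Proof.
move=> Pu; rewrite /char_poly.
have -> : char_poly_mx (invmx P *m B *m P) =
    map_mx polyC (invmx P) *m char_poly_mx B *m map_mx polyC P.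
  rewrite /char_poly_mx !map_mxM mulmxBr mulmxBl; congr (_ - _).
  by rewrite scalar_mxC -mulmxA -map_mxM mulVmx// map_mx1 mulmx1.
rewrite !det_mulmx mulrAC -det_mulmx -map_mxM mulVmx// map_mx1 det1.
by rewrite mul1r.
Qed.

Lemma mxtrace_diag_exp (F : fieldType) n (P : 'M[F]_n.+1) d k : P \in unitmx ->
  \tr ((invmx P *m diag_mx d *m P) ^+ k) = \sum_i d 0 i ^+ k.
Proof.
move=> Pu.
have -> : (invmx P *m diag_mx d *m P) ^+ k = invmx P *m diag_mx d ^+ k *m P.
  elim: k => [|k IH]; first by rewrite !expr0 mulmx1 mulVmx.
  by rewrite !exprS -!mulmxE IH !mulmxA mulmxK.
rewrite mxtrace_mulC mulmxA mulmxV// mul1mx.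
have -> : diag_mx d ^+ k = diag_mx (\row_i d 0 i ^+ k).
  elim: k => [|k IH].
    by apply/matrixP => i j; rewrite !mxE.
  rewrite exprS -mulmxE IH mulmx_diag; congr diag_mx.
  by apply/rowP => i; rewrite !mxE exprS.
by rewrite mxtrace_diag; apply: eq_bigr => i _; rewrite mxE.
Qed.

Lemma symmetric_split (R : rcfType) n (A : 'M[R]_n.+1) : A^T = A ->
  exists2 s : seq R, char_poly A = \prod_(x <- s) ('X - x%:P) &
    size s = n.+1 /\ forall k, \tr (A ^+ k) = \sum_(x <- s) x ^+ k.
Proof.
move=> At; pose AC := map_mx (real_complex R) A.
have Aherm : AC \is hermsymmx.
  apply/is_hermitianmxP; rewrite expr0 scale1r; apply/matrixP => i j.
  by rewrite !mxE -[in LHS]At mxE; symmetry; exact: conjc_real.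
have /orthomx_spectralP := hermitian_normalmx Aherm.
have := hermitian_spectral_diag_real Aherm.
have := spectral_unit AC.
move: (spectralmx AC) (spectral_diag AC) => P d Pu /mxOverP dr AE.
pose s := [seq complex.Re (d 0 i) | i <- enum 'I_n.+1].
have dE i : d 0 i = (complex.Re (d 0 i))%:C%C by rewrite RRe_real.
exists s.
  apply: (map_poly_inj (real_complex R)).
  rewrite map_char_poly -/AC AE char_poly_conj//.
  rewrite char_poly_trig ?diag_mx_is_trig// rmorph_prod/= big_map big_enum/=.
  apply: eq_bigr => i _; rewrite !mxE eqxx mulr1n rmorphB/= map_polyX map_polyC/=.
  by rewrite -dE.
split; first by rewrite size_map size_enum_ord.
move=> k; apply: (fmorph_inj (real_complex R)).
rewrite -trace_map_mx rmorphXn/= -/AC AE mxtrace_diag_exp//.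
rewrite rmorph_sum big_map big_enum/=; apply: eq_bigr => i _.
by rewrite dE rmorphXn.
Qed.

Record random_symmx d (T : measurableType d) (R : realType) n := RandomSymmx {
  symmx_fun :> T -> 'M[R]_n ;
  symmx_measurable :
    forall i j, measurable_fun [set: T] (fun w => symmx_fun w i j) ;
  symmx_sym : forall w, (symmx_fun w)^T = symmx_fun w }.

Section measurable_linear_statistics.
Context d (T : measurableType d) (R : realType) (n : nat).
Variable A : random_symmx T R n.+1.

Let lstat (g : R -> R) (w : T) : R := \sum_(x <- eigenvalues (A w)) g x.

Lemma size_eigenvalues_symmx w : size (eigenvalues (A w)) = n.+1.
Proof.
have [s sA [ss _]] := symmetric_split (symmx_sym A w).
by rewrite (perm_size (perm_eigenvalues sA)).
Qed.

Let measurable_exp k i j : measurable_fun [set: T] (fun w => (A w ^+ k) i j).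
Proof.
elim: k i j => [|k IH] i j.
  by apply: (eq_measurable_fun (cst ((1 : 'M[R]_n.+1) i j))).
apply: (eq_measurable_fun (fun w => \sum_l A w i l * (A w ^+ k) l j)).
  by move=> w _; rewrite exprS -mulmxE mxE.
apply: measurable_sum => l; apply: measurable_funM => //.
exact: symmx_measurable.
Qed.

Let measurable_lstatX k : measurable_fun [set: T] (lstat (fun x => x ^+ k)).
Proof.
apply: (eq_measurable_fun (fun w => \tr (A w ^+ k))).
  move=> w _; have [s sA [_ ->]] := symmetric_split (symmx_sym A w).
  exact/esym/perm_big/perm_eigenvalues.
by apply: measurable_sum => i; exact: measurable_exp.
Qed.

Let measurable_lstat_series (g : nat -> R -> R) (c : nat -> R) f :
  (forall k, measurable_fun [set: T] (lstat (g k))) ->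
  (forall x, series (fun k => c k * g k x) @ \oo --> f x) ->
  measurable_fun [set: T] (lstat f).
Proof.
move=> mg gf; apply: (measurable_fun_cvg (h := fun N =>
    lstat (fun x => series (fun k => c k * g k x) N))).
  move=> N; apply: (eq_measurable_fun (fun w =>
      \sum_(0 <= k < N) c k * lstat (g k) w)).
    move=> w _; rewrite /lstat /series/= exchange_big/=.
    by apply: eq_bigr => k _; rewrite mulr_sumr.
  by apply: measurable_sum => k; exact: measurable_funM.
by move=> w _; apply: cvg_big => [|x _]; [exact: add_continuous|exact: gf].
Qed.

Let measurable_lstat_cvg (h : nat -> R -> R) f :
  (forall m, measurable_fun [set: T] (lstat (h m))) ->
  (forall x, h ^~ x @ \oo --> f x) -> measurable_fun [set: T] (lstat f).
Proof.
move=> mh hf; apply: (measurable_fun_cvg (h := fun m => lstat (h m))) => //.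
by move=> w _; apply: cvg_big => [|x _]; [exact: add_continuous|exact: hf].
Qed.

Let measurable_lstat_expR c : measurable_fun [set: T] (lstat (fun x => expR (c * x))).
Proof.
apply: (measurable_lstat_series (g := fun k x => x ^+ k)
  (c := fun k => c ^+ k / k`!%:R)) => // x.
rewrite (_ : (fun _ => _) = exp_coeff (c * x)); first exact: is_cvg_series_exp_coeff.
by apply/funext => k; rewrite /exp_coeff/= exprMn mulrAC.
Qed.

Let measurable_lstat_expRexpR a c :
  measurable_fun [set: T] (lstat (fun x => expR (a * expR (c * x)))).
Proof.
apply: (measurable_lstat_series (g := fun k x => expR (k%:R * c * x))
  (c := fun k => a ^+ k / k`!%:R)) => // x.
rewrite (_ : (fun _ => _) = exp_coeff (a * expR (c * x))).
  exact: is_cvg_series_exp_coeff.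
apply/funext => k; rewrite /exp_coeff/= exprMn mulrAC.
by rewrite -[in RHS]expRM_natl mulrA.
Qed.

Let u (t : R) (m : nat) (x : R) := expR (- expR (m%:R ^+ 2 * (x - t) - m%:R)).

Let cvg_u (t x : R) : (fun m => u t m x) @ \oo --> ((x <= t)%R%:R : R).
Proof.
rewrite /u.
have hle (m : nat) (y : R) : m%:R <= y -> expR (- y) <= harmonic m.
  move=> my; rewrite expRN /harmonic/= lef_pV2 ?posrE ?expR_gt0//.
  by rewrite (le_trans _ (expR_ge1Dx _))// -natr1 addrC lerD2l.
have [xt|tx] := leP x t.
  apply: (@squeeze_cvgr _ _ _ _ (fun m => 1 - harmonic m) (cst 1)).
  - apply: nearW => m; apply/andP; split.
      apply: le_trans (expR_ge1Dx _); rewrite lerD2l lerN2.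
      rewrite -[X in expR X]opprK; apply: hle.
      by rewrite opprB lerBrDr gerDl mulr_ge0_le0 ?exprn_ge0// subr_le0.
    by rewrite -expR0 ler_expR oppr_le0 expR_ge0.
  - rewrite -[X in _ --> X]subr0; apply: cvgB; [exact: cvg_cst|exact: cvg_harmonic].
  - exact: cvg_cst.
apply: (@squeeze_cvgr _ _ _ _ (cst 0) harmonic).
- near=> m; rewrite expR_ge0/=; apply: hle.
  apply: le_trans (expR_ge1Dx _).
  have m2 : 2 <= m%:R * (x - t).
    rewrite -ler_pdivrMr ?subr_gt0//.
    by near: m; exact: nbhs_infty_ger.
  have : m%:R * 2 <= m%:R * (m%:R * (x - t)) by rewrite ler_wpM2l.
  by rewrite mulrA -expr2; lra.
- exact: cvg_cst.
- exact: cvg_harmonic.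
Unshelve. all: by end_near. Qed.

Let lstat1 w : lstat (cst 1) w = n.+1%:R.
Proof.
rewrite /lstat/= big_const_seq count_predT iter_addr addr0.
by rewrite size_eigenvalues_symmx.
Qed.

Let measurable_lstat_ray t :
  measurable_fun [set: T] (lstat (\1_`]t, +oo[ : R -> R)).
Proof.
apply: (eq_measurable_fun (fun w => n.+1%:R - lstat (fun x => (x <= t)%R%:R) w)).
  move=> w _; apply/eqP; rewrite subr_eq /lstat -big_split/=; apply/eqP.
  rewrite -(lstat1 w); apply: eq_bigr => x _.
  by rewrite indicE mem_setE in_itv/= andbT; case: ltP; rewrite ?addr0 ?add0r.
apply: measurable_funB => //.
apply: (@measurable_lstat_cvg (u t) (fun x => (x <= t)%R%:R)); last exact: cvg_u.
move=> m.
apply: (eq_measurable_fun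
  (lstat (fun x => expR (- expR (- (m%:R ^+ 2 * t) - m%:R) * expR (m%:R ^+ 2 * x))))).
  move=> w _; apply: eq_bigr => x _; rewrite /u mulNr -expRD.
  by do 3 congr expR || congr (- _); lra.
exact: measurable_lstat_expRexpR.
Qed.

Lemma measurable_lstat_indic (B : set R) : measurable B ->
  measurable_fun [set: T] (fun w => \sum_(x <- eigenvalues (A w)) \1_B x : R).
Proof.
have mE : (@measurable _ R) = <<s @RGenOInfty.G R >> by exact: RGenOInfty.measurableE.
rewrite mE; move: B; apply: (dynkin_induction
  (P := fun B => measurable_fun [set: T] (lstat (\1_B : R -> R))) mE).
- move=> _ _ [x ->] [y ->]; exists (Num.max x y).
  by apply/seteqP; split => z /=; rewrite !in_itv/= !andbT gt_max; [case=> -> ->|move/andP].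
- apply: (eq_measurable_fun (cst (n.+1%:R : R))) => // w _.
  rewrite -(lstat1 w); apply: eq_bigr => x _.
  by rewrite indicE in_setT.
- by move=> _ [t ->]; exact: measurable_lstat_ray.
- move=> B mB mlB; apply: (eq_measurable_fun (fun w => n.+1%:R - lstat \1_B w)).
    move=> w _; apply/eqP; rewrite subr_eq /lstat -big_split/=; apply/eqP.
    rewrite -(lstat1 w); apply: eq_bigr => x _.
    by rewrite !indicE in_setC; case: (x \in B); rewrite ?addr0 ?add0r.
  exact: measurable_funB.
- move=> F mF tF mlF.
  apply: (measurable_lstat_series (g := fun k => \1_(F k)) (c := fun=> 1)) => // x.
  have Fx0 k : (0 <= (\1_(F k) x)%:E :> \bar R)%E by rewrite lee_fin.
  have /fine_cvgP[_] : (fun N => (series (fun k => 1 * \1_(F k) x) N)%:E) @ \oo -->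
      (\1_(\bigcup_k F k) x : R)%:E.
    rewrite indic_bigcup//; apply: cvg_trans (is_cvg_nneseries _) => //.
    apply: near_eq_cvg; apply: nearW => N /=; rewrite /series/= -sumEFin.
    by apply: eq_bigr => k _; rewrite mul1r.
  exact.
Qed.

End measurable_linear_statistics.

Definition mutually_independent d (T : measurableType d) (R : realType)
    (P : probability T R) (I : finType) (X : I -> T -> R) : Prop :=
  forall (J : {set I}) (B : I -> set R), (forall i, measurable (B i)) ->
    P (\bigcap_(i in [set i | i \in J]) (X i @^-1` B i)) =
    (\prod_(i in J) P (X i @^-1` B i))%E.

(* The second parameter of normal_prob is the standard deviation. *)
Record is_GOE d (T : measurableType d) (R : realType) (P : probability T R) n
    (A : random_symmx T R n) : Prop := IsGOE {
  GOE_independent : mutually_independent P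
    (fun (p : {p : 'I_n * 'I_n | (p.1 <= p.2)%N}) w =>
       A w (val p).1 (val p).2) ;
  GOE_gaussian : forall (i j : 'I_n) (B : set R), (i <= j)%N -> measurable B ->
    P ((fun w => A w i j) @^-1` B) =
    normal_prob 0 (Num.sqrt (if i == j then 2 / n%:R else 1 / n%:R)) B }.

Definition esd (R : realType) n (A : 'M[R]_n) (B : set R) : \bar R :=
  ((n%:R^-1)%:E * \sum_(x <- eigenvalues A) \d_x B)%E.

Definition averaged_esd d (T : measurableType d) (R : realType)
    (P : probability T R) n (A : random_symmx T R n.+1) : set R -> \bar R :=
  fun B => (\int[P]_w esd (A w) B)%E.

Section averaged_esd_probability.
Context d (T : measurableType d) (R : realType) (P : probability T R) (n : nat).
Variable A : random_symmx T R n.+1.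
Local Notation mu := (averaged_esd P A).

Let esd_ge0 w B : (0 <= esd (A w) B)%E.
Proof. by rewrite mule_ge0 ?lee_fin// sume_ge0. Qed.

Let measurable_esd B : measurable B ->
  measurable_fun [set: T] (fun w => esd (A w) B).
Proof.
move=> mB; apply: (eq_measurable_fun (fun w =>
    (n.+1%:R^-1 * \sum_(x <- eigenvalues (A w)) \1_B x : R)%:E)).
  by move=> w _; rewrite /esd EFinM -sumEFin.
apply/measurable_EFinP; apply: measurable_funM => //.
exact: measurable_lstat_indic.
Qed.

Let averaged_esd0 : mu set0 = 0%E.
Proof.
rewrite /averaged_esd integral0_eq// => w _.
by rewrite /esd big1 ?mule0// => x _; rewrite measure0.
Qed.

Let averaged_esd_ge0 B : (0 <= mu B)%E.
Proof. exact: integral_ge0. Qed.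

Let averaged_esd_sigma_additive : semi_sigma_additive mu.
Proof.
move=> F mF tF mUF; rewrite /averaged_esd.
have -> : (\int[P]_w esd (A w) (\bigcup_k F k))%E =
    (\int[P]_w \sum_(0 <= k <oo) esd (A w) (F k))%E.
  apply: eq_integral => w _; rewrite /esd nneseriesZl//; last first.
    by move=> k _; exact: sume_ge0.
  rewrite nneseries_sum//; congr (_ * _)%E; apply: eq_bigr => x _.
  by rewrite measure_semi_bigcup.
rewrite integral_nneseries//; last by move=> k; exact: measurable_esd.
apply: is_cvg_nneseries => k _ _; exact: integral_ge0.
Qed.

HB.instance Definition _ := isMeasure.Build _ _ _ mu
  averaged_esd0 averaged_esd_ge0 averaged_esd_sigma_additive.

Let averaged_esd_setT : mu [set: R] = 1%E.
Proof.
rewrite /averaged_esd (eq_integral (cst 1%E)) ?integral_cst ?mul1e//=.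
  exact: probability_setT.
move=> w _; rewrite /esd (eq_bigr (fun=> 1%:E)); last first.
  by move=> x _; rewrite diracT.
rewrite sumEFin big_const_seq count_predT iter_addr addr0.
by rewrite size_eigenvalues_symmx -EFinM mulVf.
Qed.

HB.instance Definition _ :=
  @Measure_isProbability.Build _ _ R mu averaged_esd_setT.

End averaged_esd_probability.

Definition semicircle_pdf (R : realType) (x : R) : R :=
  Num.sqrt (4 - x ^+ 2) / (2 * pi).

Definition semicircle (R : realType) : set R -> \bar R := fun B =>
  (\int[@lebesgue_measure R]_(x in B `&` `[(-2)%R, 2%R]) (semicircle_pdf x)%:E)%E.

Arguments semicircle R : clear implicits.

Section semicircle_probability.
Context (R : realType).
Local Notation mu := (@lebesgue_measure R).
Local Notation sc := (@semicircle R).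

Let semicircle_pdf_ge0 (x : R) : 0 <= semicircle_pdf x.
Proof. by rewrite divr_ge0 ?sqrtr_ge0// mulr_ge0// pi_ge0. Qed.

Let continuous_semicircle_pdf : continuous (@semicircle_pdf R).
Proof.
move=> x; apply: cvgM; last exact: cvg_cst.
apply: (continuous_comp (f := fun x : R => 4 - x ^+ 2)); last exact: sqrt_continuous.
by apply: cvgB; [exact: cvg_cst|exact: exprn_continuous].
Qed.

Let measurable_semicircle_pdf D : measurable_fun D (@semicircle_pdf R).
Proof. by apply: measurable_funTS; apply: continuous_measurable_fun. Qed.

Let semicircle0 : sc set0 = 0%E.
Proof. by rewrite /semicircle set0I integral_set0. Qed.

Let semicircle_ge0 B : (0 <= sc B)%E.
Proof. by apply: integral_ge0 => x _; rewrite lee_fin. Qed.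

Let semicircle_sigma_additive : semi_sigma_additive sc.
Proof.
move=> F mF tF mUF; rewrite /semicircle setI_bigcupl.
have mpdf D : measurable_fun D (EFin \o @semicircle_pdf R).
  by apply: measurableT_comp => //; exact: measurable_semicircle_pdf.
rewrite ge0_integral_bigcup.
- apply: is_cvg_nneseries => n _ _.
  by apply: integral_ge0 => x _; rewrite lee_fin.
- by move=> n; apply: measurableI; [exact: mF|exact: measurable_itv].
- exact: mpdf.
- by move=> x _; rewrite lee_fin.
- exact: trivIset_setIr.
Qed.

HB.instance Definition _ := isMeasure.Build _ _ _ sc
  semicircle0 semicircle_ge0 semicircle_sigma_additive.

Let semicircle_setT : sc [set: R] = 1%E.
Proof.
rewrite /semicircle setTI.
have pi20 : 0 < pi / 2 :> R by rewrite divr_gt0 ?pi_gt0.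
have pi0 : pi != 0 :> R by rewrite gt_eqF ?pi_gt0.
have h : - (pi / 2) < pi / 2 :> R by rewrite gtrN.
pose F : R -> R := fun t => 2 * sin t.
have dF (t : R) : is_derive t 1 F (2 * cos t).
  by apply: is_deriveZ.
have F'E : derive1 F = fun t => 2 * cos t.
  by apply/funext => t; rewrite derive1E derive_val.
have cF : continuous F.
  by move=> t; apply: cvgM; [exact: cvg_cst|exact: continuous_sin].
have cF' : continuous (derive1 F).
  by rewrite F'E => t; apply: cvgM; [exact: cvg_cst|exact: continuous_cos].
have -> : `[(-2)%R, 2%R]%classic = `[F (- (pi / 2)), F (pi / 2)]%classic.
  by rewrite /F sinN sin_pihalf mulrN !mulr1.
rewrite integration_by_substitution_increasing ?(ltW h)//; first last.
- exact: continuous_subspaceT.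
- split=> [t _| |]; first exact: ex_derive.
  + exact/cvg_at_right_filter/cF.
  + exact/cvg_at_left_filter/cF.
- by apply/cvg_ex; exists (derive1 F (pi / 2)); exact: cvg_at_left_filter (cF' _).
- by apply/cvg_ex; exists (derive1 F (- (pi / 2))); exact/cvg_at_right_filter/cF'.
- apply: gtr0_derive1_lt_cc => [t _|t|]; first exact: ex_derive.
  + by rewrite in_itv/= F'E => tpi; rewrite mulr_gt0// cos_gt0_pihalf.
  + exact: continuous_subspaceT.
pose f : R -> R := fun t => 2 / pi * cos t ^+ 2.
pose H : R -> R := fun t => pi^-1 * (t + sin t * cos t).
transitivity (\int[mu]_(t in `[(- (pi / 2))%R, (pi / 2)%R]) (f t)%:E)%E.
  apply: eq_integral => t; rewrite inE/= in_itv/= => tpi; congr (_%:E).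
  rewrite /f /semicircle_pdf fctE F'E /F /=.
  have -> : 4 - (2 * sin t) ^+ 2 = (2 * cos t) ^+ 2.
    by rewrite !exprMn cos2sin2; ring.
  rewrite sqrtr_sqr ger0_norm; last by rewrite mulr_ge0// cos_ge0_pihalf.
  have fE (p c : R) : p != 0 -> 2 * c / (2 * p) * (2 * c) = 2 / p * c ^+ 2.
    by move=> p0; field.
  exact: fE.
have dH (t : R) : is_derive t 1 H (pi^-1 * (1 + (sin t * - sin t + cos t * cos t))).
  by apply: is_deriveZ.
have cH : continuous H.
  by move=> t; apply/differentiable_continuous/derivable1_diffP/ex_derive.
have cf : continuous f.
  move=> t; apply: cvgM; first exact: cvg_cst.
  exact: (continuous_comp (@continuous_cos R t) (@exprn_continuous R 2 _)).
rewrite (@continuous_FTC2 _ f H)//.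
- rewrite -EFinB /H !cosN !cos_pihalf !mulr0 !addr0.
  by rewrite mulrN opprK -mulrDr -splitr mulVf.
- exact: continuous_subspaceT.
- split=> [t _| |]; first exact: ex_derive.
  + exact/cvg_at_right_filter/cH.
  + exact/cvg_at_left_filter/cH.
- move=> t _; rewrite derive1E derive_val /f.
  have gE (p c : R) : p * (1 + (- (1 - c ^+ 2) + c ^+ 2)) = 2 * p * c ^+ 2 by ring.
  by rewrite mulrN -!expr2 sin2cos2 gE.
Qed.

HB.instance Definition _ :=
  @Measure_isProbability.Build _ _ R sc semicircle_setT.

End semicircle_probability.

Definition integralC (R : realType) (mu : {measure set R -> \bar R})
    (f : R -> R[i]) : R[i] :=
  Complex (\int[mu]_x complex.Re (f x))%R (\int[mu]_x complex.Im (f x))%R.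

Definition weak_cvg (R : realType) (mu : nat -> probability R R)
    (nu : probability R R) : Prop :=
  forall f : R -> R[i]^o, continuous f ->
    (exists M : R, forall x, `|f x| <= (M%:C)%C) ->
    (fun n => integralC (mu n) f : R[i]^o) @ \oo --> (integralC nu f : R[i]^o).

(* Main.v *)
Require Import Defs.
From HB Require Import structures.
From mathcomp Require Import all_boot all_order all_algebra.
From mathcomp Require Import finmap complex.
From mathcomp Require Import all_classical all_reals all_analysis.
From mathcomp Require Import measurable_realfun ring lra zify.

(** The moments of the averaged eigenvalue distribution are computed by Gaussian
    integration by parts and compared with those of the semicircle.

    Write N for the size of the matrix A, tau_k = tr(A^k) / N, and let E be the
    expectation.  The entries of A form a centered Gaussian family with
    E[a_ij a_kl] = ([(i,j) = (k,l)] + [(i,j) = (l,k)]) / N, so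
    E[a_ij F(A)] = E[D_ij F(A)] / N for polynomial F, where D_ij is the
    derivation with D_ij a_kl = [(i,j) = (k,l)] + [(i,j) = (l,k)]
    (gaussian_ibp).  Applied to
    tr(A^(k+1)) Q = sum_ij a_ij (A^k)_ji Q with Q a product of traces, it gives
    the loop equation (mean_traces_loop)

      E[tau_(k+1) q] = sum_(a < k) E[tau_a tau_(k-1-a) q]
                       + (k / N) E[tau_(k-1) q] + (1 / N^2) (...)

    whose right-hand side involves only products of traces of smaller total
    degree.  Keeping arbitrary products of traces, instead of single traces, is
    what closes the recursion without any variance estimate: by induction on the
    total degree, E[tau_(k_1) ... tau_(k_r)] tends to c_(k_1) ... c_(k_r), where
    c_0 = 1 and c_(k+1) = sum_(a < k) c_a c_(k-1-a) (loop_equation_limit).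

    The semicircle moments satisfy this recursion
    (semicircle_moment_convolution): integrating the derivative of
    x^k (4 - x^2)^(3/2) over [-2, 2] gives (k + 3) c_(k+1) = 4 k c_(k-1), and
    the convolution identity for the Catalan numbers follows from it.

    Finally convergence of moments implies weak convergence because the 2k-th
    moment of the limit is at most 2^(2k) (cvg_moments_bounded_continuous): a
    bounded continuous f is approximated uniformly on [-3, 3] by a polynomial p,
    and outside |f - p| is at most C (x/3)^(2m) for every large m, whose
    integral is asymptotically at most C (2/3)^(2m). *)

Set Implicit Arguments.
Unset Strict Implicit.
Unset Printing Implicit Defensive.

Import Order.TTheory GRing.Theory Num.Theory.
Import numFieldNormedType.Exports.

Local Open Scope classical_set_scope.
Local Open Scope ring_scope.

(** * Integration against mixtures of point masses *)

Lemma Rintegral_sum d (T : measurableType d) (R : realType)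
    (mu : {measure set T -> \bar R}) (J : Type) (s : seq J) (F : J -> T -> R) :
  (forall j, mu.-integrable setT (EFin \o F j)) ->
  mu.-integrable setT (EFin \o (fun w => \sum_(j <- s) F j w)) /\
  \int[mu]_w (\sum_(j <- s) F j w) = \sum_(j <- s) \int[mu]_w F j w.
Proof.
move=> iF; elim: s => [|j s [IH1 IH2]].
  rewrite big_nil; split.
    by apply: eq_integrable (integrable0 _ _) => // w _; rewrite /= big_nil.
  by under eq_Rintegral do rewrite big_nil; rewrite Rintegral_cst// mul0r.
split; last first.
  by under eq_Rintegral do rewrite big_cons; rewrite RintegralD// big_cons IH2.
by apply: eq_integrable (integrableD _ (iF j) IH1) => // w _; rewrite /= big_cons EFinD.
Qed.

Lemma cvg_integral_nondecreasing d (T : measurableType d) (R : realType)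
    (P : {measure set T -> \bar R}) (g : nat -> T -> R) (f : T -> R) :
  (forall n, measurable_fun [set: T] (g n)) -> (forall n x, 0 <= g n x) ->
  (forall x, nondecreasing_seq (g ^~ x)) -> (forall x, g ^~ x @ \oo --> f x) ->
  (\int[P]_x (g n x)%:E)%E @[n --> \oo] --> (\int[P]_x (f x)%:E)%E.
Proof.
move=> mg g0 ndg gf.
rewrite (eq_integral (fun x => limn (fun n => (g n x)%:E))); last first.
  move=> x _; apply/esym/cvg_lim => //.
  by apply: cvg_EFin; [exact: nearW|exact: gf].
apply: cvg_monotone_convergence => //.
- by move=> n; exact/measurable_EFinP.
- by move=> n x _; rewrite lee_fin.
- by move=> x _ m n mn; rewrite lee_fin; exact: ndg.
Qed.

(** The measure mu is a mixture, over the points w of a measure space, of finite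
    sums of point masses of weight c w sitting at s w.  This one situation covers
    averaged eigenvalue distributions (s w lists the eigenvalues), measures given
    by a density (s w = [:: w]), laws of random variables (c w = 1), and the law
    of X weighted by an independent factor (s w = [:: X w]).  The points of s w
    need not depend measurably on w, only the resulting measures do. *)
Section mixture.
Context d d' (T : measurableType d) (U : measurableType d') (R : realType).
Variables (P : {measure set T -> \bar R}) (mu : {measure set U -> \bar R}).
Variables (s : T -> seq U) (c : T -> R).
Hypothesis c_ge0 : forall w, 0 <= c w.

Let K (f : U -> R) w := c w * \sum_(x <- s w) f x.

Hypothesis mK : forall B, measurable B -> measurable_fun [set: T] (K \1_B).
Hypothesis muE : forall B, measurable B -> mu B = (\int[P]_w (K \1_B w)%:E)%E.

Let K_ge0 f w : (forall x, 0 <= f x) -> 0 <= K f w.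
Proof. by move=> f0; rewrite mulr_ge0// sumr_ge0. Qed.

Import HBNNSimple.

Let K_nnsfun (f : {nnsfun U >-> R}) w :
  K f w = \sum_(r <- enum_fset (fset_set (range f))) r * K \1_(f @^-1` [set r]) w.
Proof.
rewrite /K (eq_bigr _ (fun x _ => fimfunE f x)).
under eq_bigr do rewrite fsbig_finite//=.
rewrite exchange_big/= mulr_sumr; apply: eq_bigr => r _.
by rewrite -mulr_sumr mulrCA.
Qed.

Let mixture_nnsfun (f : {nnsfun U >-> R}) :
  measurable_fun [set: T] (K f) /\
  (\int[mu]_x (f x)%:E = \int[P]_w (K f w)%:E)%E.
Proof.
have mpre r : measurable (f @^-1` [set r]).
  by rewrite -[X in measurable X]setTI; exact: measurable_funP.
have mt r : measurable_fun [set: T] (fun w => r * K \1_(f @^-1` [set r]) w).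
  by apply: measurable_funM => //; exact: mK.
have t0 r w : 0 <= r * K \1_(f @^-1` [set r]) w.
  have [r0|r0] := leP 0 r; first by rewrite mulr_ge0// K_ge0.
  by rewrite /K preimage_nnfun0// big1 ?mulr0// => x _; rewrite indic0.
split.
  apply: (eq_measurable_fun _ (fun w _ => esym (K_nnsfun f w))).
  exact: measurable_sum.
rewrite integralT_nnsfun sintegralE fsbig_finite//=.
under [in RHS]eq_integral do rewrite K_nnsfun -sumEFin.
rewrite ge0_integral_sum//=; last 2 first.
- by move=> r; exact/measurable_EFinP.
- by move=> r w _; rewrite lee_fin.
apply: eq_bigr => r _; rewrite muE//.
have [r0|r0] := leP 0 r.
  under [in RHS]eq_integral do rewrite EFinM.
  rewrite ge0_integralZl//; first exact/measurable_EFinP/mK.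
  by move=> w _; rewrite lee_fin K_ge0.
rewrite -muE// preimage_nnfun0// measure0 mule0 integral0_eq// => w _.
by rewrite /K big1 ?mulr0// => x _; rewrite indic0.
Qed.

Lemma ge0_mixture (f : U -> R) : (forall x, 0 <= f x) ->
    measurable_fun [set: U] f ->
  measurable_fun [set: T] (fun w => c w * \sum_(x <- s w) f x) /\
  (\int[mu]_x (f x)%:E = \int[P]_w (c w * \sum_(x <- s w) f x)%:E)%E.
Proof.
move=> f0 mf; have mEf := proj2 (measurable_EFinP _ _) mf.
pose f_ := nnsfun_approx measurableT mEf.
have f_f x : (f_ n x)%:E @[n --> \oo] --> (f x)%:E.
  by apply: (@cvg_nnsfun_approx _ _ _ _ measurableT _ mEf) => //= y _; rewrite lee_fin.
have nd x : {homo (fun n => f_ n x) : m n / (m <= n)%N >-> m <= n}.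
  by move=> m n mn; exact/lefP/nd_nnsfun_approx.
have Kf w : K (f_ n) w @[n --> \oo] --> K f w.
  apply: cvgM; first exact: cvg_cst.
  apply: cvg_big => [|x _]; first exact: add_continuous.
  have : (f_ n x)%:E @[n --> \oo] --> (f x)%:E by exact: f_f.
  by move=> /fine_cvgP[_].
have mKf : measurable_fun [set: T] (K f).
  apply: (measurable_fun_cvg (h := fun n => K (f_ n))) => //.
  by move=> n; have [] := mixture_nnsfun (f_ n).
split => //.
have muf : (\int[mu]_x (f_ n x)%:E)%E @[n --> \oo] --> (\int[mu]_x (f x)%:E)%E.
  apply: cvg_integral_nondecreasing => // x.
  have : (f_ n x)%:E @[n --> \oo] --> (f x)%:E by exact: f_f.
  by move=> /fine_cvgP[_].
have PKf : (\int[P]_w (K (f_ n) w)%:E)%E @[n --> \oo] --> (\int[P]_w (K f w)%:E)%E.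
  apply: cvg_integral_nondecreasing => //.
  - by move=> n; have [] := mixture_nnsfun (f_ n).
  - by move=> n w; rewrite K_ge0.
  - move=> w m n mn; rewrite ler_wpM2l//.
    by apply: ler_sum => x _; exact: nd.
apply: (cvg_unique _ muf) => //=.
rewrite (_ : (fun n => _) = (fun n => \int[P]_w (K (f_ n) w)%:E)%E)//.
by apply/funext => n; have [] := mixture_nnsfun (f_ n).
Qed.

Lemma integrable_mixture (f : U -> R) : measurable_fun [set: U] f ->
    (\int[P]_w (c w * \sum_(x <- s w) `|f x|)%:E < +oo)%E ->
  mu.-integrable [set: U] (EFin \o f).
Proof.
move=> mf foo; apply/integrableP; split; first exact/measurable_EFinP.
rewrite [ltLHS](_ : _ = \int[mu]_x (`|f x|)%:E)%E//.
have [|_ ->//] := @ge0_mixture (fun x => `|f x|) (fun=> normr_ge0 _).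
exact: measurableT_comp.
Qed.

Lemma Rintegral_mixture (f : U -> R) : mu.-integrable [set: U] (EFin \o f) ->
  P.-integrable [set: T] (EFin \o (fun w => c w * \sum_(x <- s w) f x)) /\
  \int[mu]_x f x = \int[P]_w (c w * \sum_(x <- s w) f x).
Proof.
move=> fi; have mf : measurable_fun [set: U] f.
  by apply/measurable_EFinP; exact: measurable_int fi.
have h (g : U -> R) : (forall x, 0 <= g x) -> measurable_fun setT g ->
    mu.-integrable setT (EFin \o g) ->
    P.-integrable [set: T] (EFin \o K g) /\ \int[mu]_x g x = \int[P]_w K g w.
  move=> g0 mg gi; have [mKg Eg] := ge0_mixture g0 mg.
  split; last by rewrite /Rintegral Eg.
  apply/integrableP; split; first exact/measurable_EFinP.
  under eq_integral do rewrite /= ger0_norm ?K_ge0//.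
  rewrite -Eg; have := integrable_lty measurableT gi; exact.
have [||i1 E1] := h f^\+ _ _ (integrable_funrpos measurableT fi) => //.
  exact: measurable_funrpos.
have [||i2 E2] := h f^\- _ _ (integrable_funrneg measurableT fi) => //.
  exact: measurable_funrneg.
have KE w : K f w = K f^\+ w - K f^\- w.
  rewrite /K -mulrBr -sumrB; congr (_ * _); apply: eq_bigr => x _.
  by rewrite -[in LHS](funrposBneg f).
rewrite -/(K f) (_ : K f = fun w => K f^\+ w - K f^\- w); last exact/funext.
split.
  have := integrableB measurableT i1 i2; exact: eq_integrable.
rewrite RintegralB// -E1 -E2 -RintegralB//; last 2 first.
- exact: integrable_funrpos.
- exact: integrable_funrneg.
by apply: eq_Rintegral => x _; rewrite -[in LHS](funrposBneg f).
Qed.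

End mixture.

(** The map phi is usually the identity; it allows for two distinct measurable
    structures on the same set with the same measurable sets. *)
Lemma Rintegral_density d d' (T : measurableType d) (U : measurableType d')
    (R : realType) (nu : {measure set T -> \bar R}) (mu : {measure set U -> \bar R})
    (phi : T -> U) (D : set T) (g : T -> R) :
  measurable_fun [set: T] phi ->
  measurable D -> measurable_fun [set: T] g -> (forall x, 0 <= g x) ->
  (forall B, measurable B ->
    mu B = (\int[nu]_(x in phi @^-1` B `&` D) (g x)%:E)%E) ->
  forall f : U -> R, measurable_fun [set: U] f ->
    nu.-integrable D (EFin \o (fun x => g x * f (phi x))) ->
  mu.-integrable [set: U] (EFin \o f) /\
  \int[mu]_x f x = \int[nu]_(x in D) (g x * f (phi x)).
Proof.
move=> mphi mD mg g0 muE f mf gf.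
pose c x := g x * \1_D x.
have c0 x : 0 <= c x by rewrite mulr_ge0// indicE ler0n.
have mc : measurable_fun setT c by apply: measurable_funM => //; exact: measurable_indic.
have cE (h : U -> R) x : c x * \sum_(y <- [:: phi x]) h y =
    ((fun x => g x * h (phi x)) \_ D) x.
  rewrite big_seq1 patchE /c indicE; case: ifP => _; first by rewrite mulr1.
  by rewrite mulr0 mul0r.
have mK B : measurable B ->
    measurable_fun setT (fun x => c x * \sum_(y <- [:: phi x]) \1_B y).
  move=> mB; apply: (eq_measurable_fun (fun x => c x * \1_B (phi x))).
    by move=> x _; rewrite big_seq1.
  apply: measurable_funM => //.
  by apply: (measurableT_comp (f := \1_B : U -> R)) => //; exact: measurable_indic.
have muK B : measurable B ->
    mu B = (\int[nu]_x (c x * \sum_(y <- [:: phi x]) \1_B y)%:E)%E.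
  move=> mB; rewrite muE// integral_mkcond; apply: eq_integral => x _.
  rewrite big_seq1 patchE /c !indicE in_setI.
  have -> : (x \in phi @^-1` B) = (phi x \in B) by apply/idP/idP; rewrite !inE.
  by case: (phi x \in B); case: (x \in D); rewrite ?mulr1 ?mulr0.
have fi : mu.-integrable [set: U] (EFin \o f).
  apply: (integrable_mixture c0 mK muK mf).
  move/(integrable_mkcond _ mD)/integrableP : gf => -[_].
  apply: le_lt_trans; rewrite le_eqVlt; apply/orP; left; apply/eqP.
  apply: eq_integral => x _; rewrite cE !patchE; case: ifP => _ /=.
    by rewrite normrM (ger0_norm (g0 x)).
  by rewrite normr0.
split=> //; have [_ ->] := Rintegral_mixture c0 mK muK fi.
by rewrite [RHS]Rintegral_mkcond; apply: eq_Rintegral => x _; rewrite cE.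
Qed.

(** * Polynomial approximation *)

Section bernstein.
Variable R : realType.
Implicit Types (x t : R) (n k : nat).

Definition bernstein n k : {poly R} := ('X^k * (1 - 'X) ^+ (n - k)) *+ 'C(n, k).

Let hbernstein n k t : (bernstein n k).[t] = t ^+ k * (1 - t) ^+ (n - k) *+ 'C(n, k).
Proof. by rewrite /bernstein hornerMn hornerM !horner_exp hornerD hornerN hornerX hornerC. Qed.

Lemma bernstein_ge0 n k t : 0 <= t <= 1 -> 0 <= (bernstein n k).[t].
Proof.
move=> /andP[t0 t1]; rewrite hbernstein mulrn_wge0// mulr_ge0 ?exprn_ge0//.
by rewrite subr_ge0.
Qed.

Lemma sum_bernstein n t : \sum_(k < n.+1) (bernstein n k).[t] = 1.
Proof.
have := exprDn (1 - t) t n; rewrite subrK expr1n => ->.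
by apply: eq_bigr => k _; rewrite hbernstein mulrC.
Qed.

(** The absorption identity k C(n,k) = n C(n-1,k-1) lowers n by one, so that the
    first two moments of the binomial law reduce to its total mass. *)
Lemma sum_bernstein1 n t (g : nat -> R) :
  \sum_(k < n.+2) k%:R * g k * (bernstein n.+1 k).[t] =
  n.+1%:R * t * \sum_(k < n.+1) g k.+1 * (bernstein n k).[t].
Proof.
rewrite big_ord_recl/= !mul0r add0r mulr_sumr; apply: eq_bigr => k _.
rewrite /bump/= !add1n !hbernstein subSS exprS.
rewrite -[_ *+ 'C(n.+1, _)]mulr_natr -[_ *+ 'C(n, _)]mulr_natr.
have -> : k.+1%:R * g k.+1 * (t * t ^+ k * (1 - t) ^+ (n - k) * 'C(n.+1, k.+1)%:R) =
   g k.+1 * (t * t ^+ k * (1 - t) ^+ (n - k)) * (k.+1 * 'C(n.+1, k.+1))%:R :> R.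
  rewrite natrM. ring.
rewrite -mul_bin_diag natrM /=. ring.
Qed.

Lemma variance_bernstein n t : 
  \sum_(k < n.+2) (k%:R / n.+1%:R - t) ^+ 2 * (bernstein n.+1 k).[t] =
  t * (1 - t) / n.+1%:R.
Proof.
have n0 : n.+1%:R != 0 :> R by [].
have m1 : \sum_(k < n.+2) k%:R * (bernstein n.+1 k).[t] = n.+1%:R * t.
  under eq_bigr do rewrite -[_%:R]mulr1.
  rewrite (sum_bernstein1 n t (fun=> 1)).
  by under eq_bigr do rewrite mul1r; rewrite sum_bernstein mulr1.
have m2 : \sum_(k < n.+2) k%:R ^+ 2 * (bernstein n.+1 k).[t] =
    n.+1%:R * t * (n%:R * t + 1).
  under eq_bigr do rewrite expr2.
  rewrite (sum_bernstein1 n t (fun k => k%:R)); congr (_ * _).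
  under eq_bigr do rewrite -natr1 mulrDl mul1r.
  rewrite big_split/= sum_bernstein; congr (_ + _).
  case: n {n0 m1} => [|n]; first by rewrite big_ord1 !mul0r.
  under eq_bigr do rewrite -[_%:R]mulr1.
  rewrite (sum_bernstein1 n t (fun=> 1)).
  by under eq_bigr do rewrite mul1r; rewrite sum_bernstein mulr1.
transitivity (n.+1%:R ^- 2 * (\sum_(k < n.+2) k%:R ^+ 2 * (bernstein n.+1 k).[t]) -
   2 * t / n.+1%:R * (\sum_(k < n.+2) k%:R * (bernstein n.+1 k).[t]) +
   t ^+ 2 * \sum_(k < n.+2) (bernstein n.+1 k).[t]).
  rewrite !mulr_sumr -sumrB -big_split/=; apply: eq_bigr => k _.
  by field; rewrite addrC natr1.
rewrite sum_bernstein m1 m2 -natr1; field.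
by rewrite natr1.
Qed.

End bernstein.

Section weierstrass.
Variable R : realType.
Implicit Types (f : R -> R) (e : R).

(** By compactness: around each point of [a, b] a single modulus works. *)
Lemma uniform_continuity_itv f (a b : R) e : continuous f -> 0 < e ->
  exists2 delta, 0 < delta & forall x y, a <= x <= b -> `|y - x| <= delta ->
    `|f y - f x| <= e.
Proof.
move=> cf e0; pose P (n : nat) x := forall y, `|y - x| <= n.+1%:R^-1 -> `|f y - f x| <= e.
have /compact_near_coveringP/near_covering_withinP cov := @segment_compact R a b.
have : \forall n \near \oo, `[a, b] `<=` P n.
  apply: cov => x _; rewrite /prop_near1.
  have e20 : 0 < e / 2 by rewrite divr_gt0.
  have /cvgrPdist_le/(_ _ e20)/nbhs_ballP[r /= r0 rf] := cf x.
  have r20 : 0 < r / 2 by rewrite divr_gt0.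
  near=> x' n => _ y yx'.
  have xx' : `|x - x'| < r / 2 by near: x'; exact: nbhsx_ballx.
  have nr : n.+1%:R^-1 < r / 2 by near: n; exact: near_infty_natSinv_lt (PosNum r20).
  have h1 : `|f x - f x'| <= e / 2.
    by apply: rf; rewrite /ball/= (lt_trans xx')// ltr_pdivrMr// ltr_pMr// ltr1n.
  have h2 : `|f x - f y| <= e / 2.
    apply: rf; rewrite /ball/= [r]splitr (le_lt_trans (ler_distD x' _ _))//.
    by rewrite ltrD// distrC (le_lt_trans yx').
  rewrite [e]splitr (le_trans (ler_distD (f x) _ _))// lerD//.
  by rewrite distrC.
move=> [n _ /(_ n (leqnn n)) h]; exists n.+1%:R^-1; first by rewrite invr_gt0.
by move=> x y xab; apply: h; rewrite /= in_itv.
Unshelve. all: by end_near. Qed.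

(** Bernstein's proof: where k/n is close to t uniform continuity bounds
    |f t - f (k/n)|, elsewhere it is at most C (k/n - t)^2, and the sum of the
    latter is C times the variance of the binomial law, of order 1/n. *)
Lemma weierstrass01 f e : continuous f -> 0 < e ->
  exists p : {poly R}, forall t, 0 <= t <= 1 -> `|f t - p.[t]| <= e.
Proof.
move=> cf e0; have e20 : 0 < e / 2 by rewrite divr_gt0.
have [delta d0 df] := uniform_continuity_itv 0 1 cf e20.
have [c _ fc] : exists2 c, c \in `[0, 1]%R &
    forall t : R, t \in `[0, 1]%R -> `|f t| <= `|f c|.
  apply: (@EVT_max _ (fun t => `|f t|)) => //.
  by apply: continuous_subspaceT => t; apply: cvg_norm; exact: cf.
pose C := 2 * `|f c| / delta ^+ 2.
have C0 : 0 <= C by apply: divr_ge0; [exact: mulr_ge0|exact: sqr_ge0].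
have [n nC] : exists n : nat, C / n.+1%:R <= e / 2.
  exists (Num.truncn (C / (e / 2))).
  rewrite ler_pdivrMr// mulrC -ler_pdivrMr// ltW// truncnS_gt//.
exists (\sum_(k < n.+2) f (k%:R / n.+1%:R) *: bernstein R n.+1 k) => t t01.
have -> : (\sum_(k < n.+2) f (k%:R / n.+1%:R) *: bernstein R n.+1 k).[t] =
    \sum_(k < n.+2) f (k%:R / n.+1%:R) * (bernstein R n.+1 k).[t].
  by rewrite horner_sum; apply: eq_bigr => k _; rewrite hornerZ.
rewrite -[X in `|X - _|]mulr1 -[X in _ * X](sum_bernstein n.+1 t).
rewrite mulr_sumr -sumrB (le_trans (ler_norm_sum _ _ _))//.
apply: (@le_trans _ _ (\sum_(k < n.+2)
    (e / 2 + C * (k%:R / n.+1%:R - t) ^+ 2) * (bernstein R n.+1 k).[t])).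
  apply: ler_sum => k _; rewrite -mulrBl normrM.
  rewrite (ger0_norm (bernstein_ge0 _ _ t01)) ler_wpM2r ?bernstein_ge0//.
  set y := _ / _.
  have y01 : 0 <= y <= 1.
    rewrite divr_ge0//= ler_pdivrMr// mul1r ler_nat.
    by rewrite -ltnS ltn_ord.
  have [yd|dy] := leP `|y - t| delta.
    by rewrite distrC (le_trans (df _ _ t01 yd))// lerDl mulr_ge0// sqr_ge0.
  have h : 2 * `|f c| <= C * (y - t) ^+ 2.
    rewrite /C mulrAC ler_pdivlMr ?exprn_gt0// ler_wpM2l ?mulr_ge0//.
    by rewrite -[leRHS]real_normK ?num_real// lerXn2r ?nnegrE// ltW.
  rewrite (le_trans (ler_normB _ _))// (le_trans _ (lerD (ltW e20) h))// add0r.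
  by rewrite mulrC mulr_natr mulr2n lerD// fc// in_itv.
under eq_bigr do rewrite mulrDl -(mulrA C).
rewrite big_split/= -!mulr_sumr sum_bernstein variance_bernstein mulr1.
rewrite [leRHS]splitr lerD// (le_trans _ nC)// mulrA ler_wpM2r ?invr_ge0//.
move/andP : t01 => [t0 t1].
by rewrite ler_piMr// mulr_ile1// ?subr_ge0// gerBl.
Qed.

Lemma weierstrass f (a e : R) : continuous f -> 0 < a -> 0 < e ->
  exists p : {poly R}, forall x, - a <= x <= a -> `|f x - p.[x]| <= e.
Proof.
move=> cf a0 e0; pose g t := f (2 * a * t - a).
have cg : continuous g.
  move=> t; apply: (@continuous_comp _ _ _ (fun t => 2 * a * t - a) f); last exact: cf.
  apply: cvgB; last exact: cvg_cst.
  by apply: cvgM; [exact: cvg_cst|exact: cvg_id].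
have [q hq] := weierstrass01 cg e0.
exists (q \Po ((2 * a)^-1 *: ('X + a%:P))) => x /andP[ax xa].
have a20 : 0 < 2 * a by rewrite mulr_gt0.
rewrite horner_comp !hornerE.
have := hq ((2 * a)^-1 * (x + a)).
rewrite /g mulrA divff ?gt_eqF// mul1r addrK; apply.
rewrite [_^-1 * _]mulrC divr_ge0 ?(ltW a20)//=; last by lra.
by rewrite ler_pdivrMr// mul1r mulr2n mulrDl mul1r lerD2r.
Qed.

End weierstrass.

(** * Convergence of moments and weak convergence *)

Section moment_method.
Variable R : realType.

Let poly_integral (mu : probability R R) (p : {poly R}) :
  (forall k, mu.-integrable setT (EFin \o (fun x : R => x ^+ k))) ->
  mu.-integrable setT (EFin \o (fun x => p.[x])) /\
  \int[mu]_x p.[x] = \sum_(i < size p) p`_i * \int[mu]_x x ^+ i.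
Proof.
move=> mi.
have mpi (i : 'I_(size p)) : mu.-integrable setT (EFin \o (fun x => p`_i * x ^+ i)).
  by apply: eq_integrable (integrableZl measurableT p`_i (mi i)).
have [i1 E1] := Rintegral_sum (index_enum 'I_(size p)) mpi.
split.
  by apply: eq_integrable i1 => // x _; rewrite /= horner_coef.
under eq_Rintegral do rewrite horner_coef.
by rewrite E1; apply: eq_bigr => i _; rewrite RintegralZl.
Qed.

Let integrable_bounded_cont (mu : probability R R) (f : R -> R) M :
  continuous f -> (forall x, `|f x| <= M) -> mu.-integrable setT (EFin \o f).
Proof.
move=> cf fM; apply: (le_integrable measurableT _ _ (finite_measure_integrable_cst mu M measurableT)).
  by apply/measurable_EFinP; exact: continuous_measurable_fun.
by move=> x _; rewrite /= lee_fin (le_trans (fM x))// ler_norm.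
Qed.

(** On [-a, a] the bound is e; outside, every power of |x| / a up to the size of p
   is dominated by (|x| / a) ^ (2 m). *)
Let tail_le (f : R -> R) M (p : {poly R}) a e m : 0 < a -> 0 <= e ->
  (forall x, `|f x| <= M) -> (forall x, - a <= x <= a -> `|f x - p.[x]| <= e) ->
  (size p <= m)%N ->
  forall x, `|f x - p.[x]| <=
    e + (M + \sum_(i < size p) `|p`_i| * a ^+ i) / a ^+ (2 * m) * x ^+ (2 * m).
Proof.
move=> a0 e0 fM fp pm x; set C := M + _.
have M0 : 0 <= M by apply: le_trans (fM 0); exact: normr_ge0.
have C0 : 0 <= C.
  by rewrite addr_ge0// sumr_ge0// => i _; rewrite mulr_ge0// exprn_ge0// ltW.
have x2m : x ^+ (2 * m) = `|x| ^+ (2 * m).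
  by rewrite !exprM real_normK ?num_real.
have [xa|ax] := leP `|x| a.
  rewrite (le_trans (fp x _)) -?ler_norml// lerDl mulr_ge0//.
    by rewrite divr_ge0// exprn_ge0// ltW.
  by rewrite x2m exprn_ge0.
rewrite ler_wpDl// x2m mulrAC -mulrA -expr_div_n.
have xa1 : 1 <= `|x| / a by rewrite ler_pdivlMr// mul1r ltW.
rewrite (le_trans (ler_normB _ _))// /C mulrDl lerD//.
  by rewrite (le_trans (fM x))// ler_peMr// exprn_ege1.
rewrite horner_coef (le_trans (ler_norm_sum _ _ _))// mulr_suml ler_sum// => i _.
rewrite normrM normrX -mulrA ler_wpM2l//.
have a_neq0 : a != 0 by rewrite gt_eqF.
rewrite -[X in X ^+ i <= _](divfK a_neq0) exprMn mulrC.
rewrite ler_wpM2l ?exprn_ge0 ?(ltW a0)// ler_weXn2l//.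
by rewrite (leq_trans (ltnW (ltn_ord i)))// (leq_trans pm)// leq_pmull.
Qed.

(** The growth condition on the moments of nu replaces the assumption that nu is
    supported in [-b, b].  The moment of order 2m controls the tails of nu and of
    mu n alike, so no separate tightness argument is needed. *)
Lemma cvg_moments_bounded_continuous (mu : nat -> probability R R)
    (nu : probability R R) (b : R) :
  0 <= b ->
  (forall n k, (mu n).-integrable setT (EFin \o (fun x : R => x ^+ k))) ->
  (forall k, nu.-integrable setT (EFin \o (fun x : R => x ^+ k))) ->
  (forall k, \int[nu]_x x ^+ (2 * k) <= b ^+ (2 * k)) ->
  (forall k, \int[mu n]_x x ^+ k @[n --> \oo] --> \int[nu]_x x ^+ k) ->
  forall (f : R -> R) M, continuous f -> (forall x, `|f x| <= M) ->
  \int[mu n]_x f x @[n --> \oo] --> \int[nu]_x f x.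
Proof.
move=> b0 mui nui nub cvgk f M cf fM.
apply/cvgrPdist_le => eps eps0.
(* The errors add up to 2e for nu, 3e for mu n and e for the integrals of p. *)
have [e e0 epsE] : exists2 e, 0 < e & eps = 6 * e.
  by exists (eps / 6); [rewrite divr_gt0|field].
pose a := b + 1; have a0 : 0 < a by rewrite ltr_wpDl.
have [p fp] := weierstrass cf a0 e0.
pose C := M + \sum_(i < size p) `|p`_i| * a ^+ i.
have M0 : 0 <= M by apply: le_trans (fM 0); exact: normr_ge0.
have C0 : 0 <= C.
  by rewrite addr_ge0// sumr_ge0// => i _; rewrite mulr_ge0// exprn_ge0// ltW.
have ba : 0 <= b / a < 1 by rewrite divr_ge0 ?(ltW a0)//= ltr_pdivrMr// mul1r ltrDl.
have [m pm Cm] : exists2 m, (size p <= m)%N & C * (b / a) ^+ (2 * m) <= e.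
  have h : (fun k => C * (b / a) ^+ k) @ \oo --> 0.
    rewrite -[X in _ --> X](mulr0 C); apply: cvgM; first exact: cvg_cst.
    by apply: cvg_expr; rewrite ger0_norm; case/andP: ba.
  have /cvgr_le/(_ _ e0)[k _ hk] := h.
  exists (maxn (size p) k); first exact: leq_maxl.
  by apply: hk => /=; rewrite (leq_trans (leq_maxr (size p) k))// leq_pmull.
(* The error of replacing f by p, uniformly over all the measures involved. *)
have close (mu' : probability R R) :
    (forall k, mu'.-integrable setT (EFin \o (fun x : R => x ^+ k))) ->
    `|\int[mu']_x f x - \int[mu']_x p.[x]| <=
    e + C / a ^+ (2 * m) * \int[mu']_x x ^+ (2 * m).
  move=> mi; have fi := integrable_bounded_cont mu' cf fM.
  have [pi _] := poly_integral p mi.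
  rewrite -RintegralB//.
  have fpi : mu'.-integrable setT (EFin \o (fun x => f x - p.[x])).
    by apply: eq_integrable (integrableB measurableT fi pi).
  apply: le_trans (le_normr_Rintegral measurableT fpi) _.
  have ci := finite_measure_integrable_cst mu' e measurableT.
  have ti : mu'.-integrable setT (EFin \o (fun x => C / a ^+ (2 * m) * x ^+ (2 * m))).
    by apply: eq_integrable (integrableZl measurableT (C / a ^+ (2 * m)) (mi (2 * m)%N)).
  have <- : \int[mu']_x (e + C / a ^+ (2 * m) * x ^+ (2 * m)) =
      e + C / a ^+ (2 * m) * \int[mu']_x x ^+ (2 * m).
    rewrite (RintegralD measurableT ci ti) RintegralZl//. congr (_ + _).
    transitivity (e * fine (mu' setT)); first exact: Rintegral_cst.
    by rewrite probability_setT mulr1.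
  apply: le_Rintegral => //.
  - exact: integrable_norm.
  - by apply: eq_integrable (integrableD measurableT ci ti).
  - by move=> x _; apply: tail_le => //; exact: ltW.
have cp : \int[mu n]_x p.[x] @[n --> \oo] --> \int[nu]_x p.[x].
  have [_ ->] := poly_integral p nui.
  rewrite (_ : (fun n => _) = fun n => \sum_(i < size p) p`_i * \int[mu n]_x x ^+ i); last first.
    by apply/funext => n; have [_ ->] := poly_integral p (mui n).
  apply: cvg_big => [|i _]; first exact: add_continuous.
  by apply: cvgM; [exact: cvg_cst|exact: cvgk].
have nu_tail : C / a ^+ (2 * m) * \int[nu]_x x ^+ (2 * m) <= e.
  apply: le_trans Cm; rewrite expr_div_n [leRHS]mulrA [leRHS]mulrAC ler_wpM2l//.
  by rewrite divr_ge0// exprn_ge0// ltW.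
have ct : (fun n => C / a ^+ (2 * m) * \int[mu n]_x x ^+ (2 * m)) @ \oo -->
    C / a ^+ (2 * m) * \int[nu]_x x ^+ (2 * m).
  by apply: cvgM; [exact: cvg_cst|exact: cvgk].
move/cvgrPdist_le/(_ e e0) : cp => cp; move/cvgrPdist_le/(_ e e0) : ct => ct.
near=> n.
have h1 := close nu nui; have h2 := close (mu n) (mui n).
have h3 : `|\int[nu]_x p.[x] - \int[mu n]_x p.[x]| <= e by near: n.
have h4 : `|C / a ^+ (2 * m) * \int[nu]_x x ^+ (2 * m) -
    C / a ^+ (2 * m) * \int[mu n]_x x ^+ (2 * m)| <= e by near: n.
move: h1 h2 h3 h4 nu_tail; rewrite !ler_norml epsE.
move: (\int[nu]_x f x) (\int[mu n]_x f x) (\int[nu]_x p.[x]) (\int[mu n]_x p.[x]) => u v w z.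
move: (_ * \int[nu]_x x ^+ (2 * m)) (_ * \int[mu n]_x x ^+ (2 * m)) => s t.
by lra.
Unshelve. all: by end_near. Qed.

End moment_method.

Section complex_valued.
Variable R : realType.

Let Re_Im_le (z : R[i]) (r : R) : `|z| <= r%:C%C ->
  `|complex.Re z| <= r /\ `|complex.Im z| <= r.
Proof.
rewrite normc_def lecR => h.
split; apply: le_trans h; rewrite -sqrtr_sqr ler_wsqrtr//.
  by rewrite lerDl sqr_ge0.
by rewrite lerDr sqr_ge0.
Qed.

Let norm_le (z : R[i]) (r : R) : `|complex.Re z| <= r / 2 -> `|complex.Im z| <= r / 2 ->
  `|z| <= r%:C%C.
Proof.
move=> h1 h2; rewrite normc_def lecR.
have r0 : 0 <= r by have := le_trans (normr_ge0 _) h1; rewrite ler_pdivlMr// mul0r.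
rewrite -(ger0_norm r0) -sqrtr_sqr ler_wsqrtr//.
move: h1 h2; rewrite !ler_norml => /andP[a1 a2] /andP[b1 b2]; nra.
Qed.

Lemma continuous_Re_Im (f : R -> R[i]^o) : continuous f ->
  continuous (fun x => complex.Re (f x)) /\ continuous (fun x => complex.Im (f x)).
Proof.
move=> cf; have h x (e : R) : 0 < e ->
    \forall y \near x, `|complex.Re (f x) - complex.Re (f y)| <= e /\
      `|complex.Im (f x) - complex.Im (f y)| <= e.
  move=> e0; have e0' : 0 < e%:C%C by rewrite ltcR.
  have /cvgrPdist_le/(_ _ e0') := cf x; apply: filterS => y /Re_Im_le.
  by case: (f x) (f y) => [a b] [a' b'].
by split=> x; apply/cvgrPdist_le => e /(h x); apply: filterS => y [].
Qed.

Lemma cvg_Complex (a b : nat -> R) (a' b' : R) :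
  a @ \oo --> a' -> b @ \oo --> b' ->
  (fun n => Complex (a n) (b n) : R[i]^o) @ \oo --> (Complex a' b' : R[i]^o).
Proof.
move=> ha hb; apply/cvgrPdist_le => e; rewrite ltcE/= => /andP[/eqP e1 e2].
have -> : e = (complex.Re e)%:C%C by move: e e1 {e2} => [x y] /= ->.
have e20 : 0 < complex.Re e / 2 by rewrite divr_gt0.
move/cvgrPdist_le/(_ _ e20) : ha => ha; move/cvgrPdist_le/(_ _ e20) : hb => hb.
by near=> n; apply: norm_le; near: n.
Unshelve. all: by end_near. Qed.

(** Real and imaginary parts of a bounded continuous function are bounded and
    continuous, so real test functions suffice. *)
Lemma weak_cvg_real (mu : nat -> probability R R) (nu : probability R R) :
  (forall (f : R -> R) M, continuous f -> (forall x, `|f x| <= M) ->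
     \int[mu n]_x f x @[n --> \oo] --> \int[nu]_x f x) ->
  weak_cvg mu nu.
Proof.
move=> h f /continuous_Re_Im[cr ci] [M fM]; apply: cvg_Complex.
  by apply: (h _ M) => // x; have [] := Re_Im_le (fM x).
by apply: (h _ M) => // x; have [] := Re_Im_le (fM x).
Qed.

End complex_valued.

(** * Products of independent random variables *)

Section independence.
Context d (T : measurableType d) (R : realType) (P : probability T R).
Variables (I : finType) (X : I -> T -> R).
Hypothesis mX : forall i, measurable_fun [set: T] (X i).
Hypothesis indX : mutually_independent P X.

Let upd (g : I -> R -> R) i h j := if j == i then h else g j.

Let good (g : I -> R -> R) :=
  P.-integrable [set: T] (EFin \o (fun w => \prod_i g i (X i w))) /\
  \int[P]_w (\prod_i g i (X i w)) = \prod_i \int[P]_w g i (X i w).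

(** Factors are generalized one at a time from the class C1 to the class C2, the
   others being arbitrary in C2. *)
Let good_upgrade (C1 C2 : I -> (R -> R) -> Prop) :
  (forall i h, C1 i h -> C2 i h) ->
  (forall g i, (forall j, C2 j (g j)) ->
     (forall h, C1 i h -> good (upd g i h)) -> good g) ->
  (forall g, (forall i, C1 i (g i)) -> good g) ->
  forall g, (forall i, C2 i (g i)) -> good g.
Proof.
move=> C12 step base g gC2.
suff h (s : seq I) : forall g, (forall i, C2 i (g i)) ->
    (forall i, i \notin s -> C1 i (g i)) -> good g.
  by apply: (h (enum I)) => // i; rewrite mem_enum.
elim: s => [|i s IH] {gC2}g gC2 gC1; first by apply: base => i; exact: gC1.
apply: (step g i) => // h C1h; apply: IH => j; rewrite /upd.
  by case: eqP => [->|_]; [exact: C12|exact: gC2].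
case: eqP => [->//|/eqP ji js].
by apply: gC1; rewrite inE negb_or ji.
Qed.

Let prod_upd (g : I -> R -> R) i h w :
  \prod_j upd g i h j (X j w) = h (X i w) * \prod_(j | j != i) g j (X j w).
Proof.
rewrite (bigD1 i)//= /upd eqxx; congr (_ * _).
by apply: eq_bigr => j /negPf ->.
Qed.

Let prodE_upd (g : I -> R -> R) i h :
  \prod_j \int[P]_w upd g i h j (X j w) =
  \int[P]_w h (X i w) * \prod_(j | j != i) \int[P]_w g j (X j w).
Proof.
rewrite (bigD1 i)//= /upd eqxx; congr (_ * _).
by apply: eq_bigr => j /negPf ->.
Qed.

Let upd_id (g : I -> R -> R) i : upd g i (g i) = g.
Proof. by apply/funext => j; rewrite /upd; case: eqP => // ->. Qed.

Let indic_preim i (B : set R) w : \1_B (X i w) = \1_(X i @^-1` B) w :> R.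
Proof. by rewrite !indicE; congr (_%:R); apply/idP/idP; rewrite !inE. Qed.

Let is_indic (i : I) (g : R -> R) := exists2 B, measurable B & g = \1_B.

Let ok (i : I) (g : R -> R) := measurable_fun setT g /\
  P.-integrable [set: T] (EFin \o (fun w => g (X i w))).

Let nonneg_ok i g := ok i g /\ forall x, 0 <= g x.

Let is_indic_nonneg_ok i g : is_indic i g -> nonneg_ok i g.
Proof.
move=> [B mB ->]; split => //; split; first exact: measurable_indic.
rewrite (_ : EFin \o _ = EFin \o \1_(X i @^-1` B)); last first.
  by apply/funext => w; rewrite /= indic_preim.
by apply: integrable_indic => //; rewrite -[X in measurable X]setTI; exact: mX.
Qed.

Let good_indic g : (forall i, is_indic i (g i)) -> good g.
Proof.
move=> gi; pose B i := sval (cid2 (gi i)).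
have mB i : measurable (B i) by rewrite /B; case: cid2.
have gE i : g i = \1_(B i) by rewrite /B; case: cid2.
have mXB i : measurable (X i @^-1` B i).
  by rewrite -[X in measurable X]setTI; exact: mX.
pose Z := \bigcap_(i in [set i | i \in [set: I]%SET]) (X i @^-1` B i).
have mZ : measurable Z by apply: fin_bigcap_measurable => //; exact: finite_finset.
have ZE : (fun w => \prod_i g i (X i w)) = \1_Z.
  apply/funext => w; rewrite indicE; case: (boolP (w \in Z)).
    rewrite inE => Zw; rewrite big1// => i _; rewrite gE indicE mem_set//.
    by apply: Zw; rewrite /= inE.
  move=> /negP; rewrite inE => Zw.
  have [i Bi] : exists i, ~ B i (X i w).
    by apply/existsNP => h; apply: Zw => i _; exact: h.
  by rewrite (bigD1 i)//= gE indicE memNset// mul0r.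
have PZ : P Z = (\prod_i fine (P (X i @^-1` B i)))%:E.
  have := indX [set: I]%SET mB; rewrite -/Z => ->.
  rewrite -prodEFin; apply: eq_big => [i|i _]; first by rewrite inE.
  by rewrite fineK// fin_num_measure.
split; first by rewrite ZE; exact: integrable_indic.
rewrite /Rintegral (_ : (fun w => _) = EFin \o \1_Z); last by rewrite -ZE.
transitivity (fine (P Z)); first by rewrite integral_indic// setIT.
rewrite PZ; apply: eq_bigr => i _; rewrite gE.
rewrite (_ : (fun w => _) = EFin \o \1_(X i @^-1` B i)).
  by rewrite integral_indic// setIT.
by apply/funext => w; rewrite /= indic_preim.
Qed.

Let good_nonneg g : (forall i, nonneg_ok i (g i)) -> good g.
Proof.
apply: (@good_upgrade is_indic nonneg_ok is_indic_nonneg_ok _ good_indic).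
move=> {}g i g_ok gi.
pose G w := \prod_(j | j != i) g j (X j w).
pose M := \prod_(j | j != i) \int[P]_w g j (X j w).
have G0 w : 0 <= G w by apply: prodr_ge0 => j _; have [_] := g_ok j.
have M0 : 0 <= M.
  apply: prodr_ge0 => j _; apply: Rintegral_ge0 => w _.
  by have [_] := g_ok j.
pose mX_ : {RV P >-> R} := HB.pack (X i) (isMeasurableFun.Build _ _ _ _ (X i) (mX i)).
pose nu : {measure set R -> \bar R} := mscale (NngNum M0) (distribution P mX_).
have h B : measurable B -> measurable_fun [set: T]
      (fun w => G w * \sum_(x <- [:: X i w]) \1_B x) /\
    nu B = (\int[P]_w (G w * \sum_(x <- [:: X i w]) \1_B x)%:E)%E.
  move=> mB; have [] := gi _ (ex_intro2 _ _ B mB erefl).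
  have -> : (fun w => \prod_j upd g i \1_B j (X j w)) =
     (fun w => G w * \sum_(x <- [:: X i w]) \1_B x).
    by apply/funext => w; rewrite prod_upd big_seq1 mulrC.
  move=> int E; split; first by apply/measurable_EFinP; exact: measurable_int int.
  rewrite -[RHS]fineK; last exact: integrable_fin_num.
  rewrite -[fine _]/(Rintegral _ _ _) E prodE_upd EFinM.
  transitivity (M%:E * P (X i @^-1` B))%E => //; rewrite muleC.
  congr (_ * _)%E; rewrite /Rintegral.
  rewrite (_ : (fun w => _) = EFin \o \1_(X i @^-1` B)); last first.
    by apply/funext => w; rewrite /= indic_preim.
  have mXB : measurable (X i @^-1` B) by rewrite -[X in measurable X]setTI; exact: mX.
  by rewrite integral_indic// setIT fineK// fin_num_measure.
have [[mgi igi] gi0] := g_ok i.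
(* With the other factors fixed, both sides are integrals of g i against measures
   on the line that agree on measurable sets by assumption: M times the law of
   X i, and the law of X i weighted by G. *)
have fX : \int[P]_w g i (X i w) * M = \int[nu]_x g i x.
  rewrite /Rintegral ge0_integral_mscale//=; last by move=> x _; rewrite lee_fin.
    rewrite ge0_integral_distribution//=; [|exact/measurable_EFinP].
    rewrite fineM// 1?mulrC//.
    exact: integrable_fin_num.
  exact/measurable_EFinP.
have GE w : \prod_i g i (X i w) = G w * \sum_(x <- [:: X i w]) g i x.
  by rewrite big_seq1 mulrC -[in LHS](upd_id g i) prod_upd.
have nui : nu.-integrable setT (EFin \o g i).
  apply/integrableP; split; first exact/measurable_EFinP.
  under eq_integral do rewrite /= ger0_norm//.
  rewrite ge0_integral_mscale//=; last by move=> x _; rewrite lee_fin.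
    rewrite ge0_integral_distribution//=; [|exact/measurable_EFinP].
    rewrite ltey_eq fin_numM//; exact: integrable_fin_num.
  exact/measurable_EFinP.
have [||int E] := @Rintegral_mixture _ _ _ _ _ P nu (fun w => [:: X i w]) G G0 _ _ _ nui.
- by move=> B mB; have [] := h _ mB.
- by move=> B mB; have [] := h _ mB.
split.
  rewrite (_ : (fun w => _) = fun w => G w * \sum_(x <- [:: X i w]) g i x)//.
  exact/funext.
rewrite -[in RHS](upd_id g i) prodE_upd fX E.
by apply: eq_Rintegral => w _; rewrite GE.
Qed.

Let good_int g : (forall i, ok i (g i)) -> good g.
Proof.
apply: (@good_upgrade nonneg_ok ok _ _ good_nonneg); first by move=> i h [].
move=> {}g i g_ok gi; have [mgi igi] := g_ok i.
have [|ip Ep] := gi (g i)^\+.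
  split; last by move=> x; exact: funrpos_ge0.
  by split; [exact: measurable_funrpos|exact: (integrable_funrpos measurableT igi)].
have [|im Em] := gi (g i)^\-.
  split; last by move=> x; exact: funrneg_ge0.
  by split; [exact: measurable_funrneg|exact: (integrable_funrneg measurableT igi)].
have gE w : \prod_j g j (X j w) = \prod_j upd g i (g i)^\+ j (X j w) -
    \prod_j upd g i (g i)^\- j (X j w).
  rewrite -[in LHS](upd_id g i) !prod_upd -mulrBl; congr (_ * _).
  by rewrite -[in LHS](funrposBneg (g i)).
rewrite /good (_ : (fun w => _) = fun w => \prod_j upd g i (g i)^\+ j (X j w) -
    \prod_j upd g i (g i)^\- j (X j w)); last exact/funext.
split; first by have := integrableB measurableT ip im; exact: eq_integrable.
rewrite RintegralB// Ep Em.
rewrite -[in RHS](upd_id g i) !prodE_upd -mulrBl; congr (_ * _).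
rewrite -RintegralB//.
- by apply: eq_Rintegral => w _; rewrite -[in RHS](funrposBneg (g i)).
- exact: (integrable_funrpos measurableT igi).
- exact: (integrable_funrneg measurableT igi).
Qed.

(** The definition of independence is the case of indicator functions; it extends
    to nonnegative functions by monotone convergence in each factor, and to
    integrable ones by taking positive and negative parts. *)
Lemma independent_prod (g : I -> R -> R) :
  (forall i, measurable_fun setT (g i)) ->
  (forall i, P.-integrable [set: T] (EFin \o (fun w => g i (X i w)))) ->
  P.-integrable [set: T] (EFin \o (fun w => \prod_i g i (X i w))) /\
  \int[P]_w (\prod_i g i (X i w)) = \prod_i \int[P]_w g i (X i w).
Proof. by move=> mg ig; apply: good_int => i; split; [exact: mg|exact: ig]. Qed.

End independence.

(** * Moments of the normal law *)

Section normal_moments.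
Variable R : realType.
Notation mu := (@lebesgue_measure R).
Implicit Types (s x : R) (k : nat).

Lemma expr_le_expR k (a x : R) : 0 < a ->
  `|x| ^+ k <= (1 + a ^+ k * k`!%:R) * expR (x ^+ 2 / a).
Proof.
move=> a0; have x2 : 0 <= x ^+ 2 / a by rewrite divr_ge0 ?sqr_ge0 ?ltW.
have h1 : (x ^+ 2) ^+ k <= a ^+ k * k`!%:R * expR (x ^+ 2 / a).
  have : (x ^+ 2 / a) ^+ k / k`!%:R <= expR (x ^+ 2 / a).
    case: k => [|k]; first by rewrite expr0 fact0 divr1 -expR0 ler_expR.
    by apply: le_trans (expR_ge1Dxn k x2); rewrite lerDr.
  rewrite ler_pdivrMr ?ltr0n ?fact_gt0// exprMn exprVn ler_pdivrMr ?exprn_gt0//.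
  by move=> h; rewrite (_ : a ^+ k * _ * _ = expR (x ^+ 2 / a) * k`!%:R * a ^+ k)//; ring.
rewrite mulrDl mul1r; have [x1|x1] := leP `|x| 1.
  rewrite (le_trans (exprn_ile1 _ (normr_ge0 x) x1))// ler_wpDr//.
    by rewrite !mulr_ge0 ?expR_ge0// exprn_ge0// ltW.
  by rewrite -expR0 ler_expR.
apply: le_trans (le_trans h1 _); last by rewrite lerDr expR_ge0.
rewrite -[x ^+ 2]real_normK ?num_real// -exprM ler_eXn2l//.
by rewrite mul2n -addnn leq_addr.
Qed.

(** Doubling the standard deviation absorbs any power of x; this gives the
    integrability of the powers and the vanishing of boundary terms. *)
Lemma normal_pow_le s k : s != 0 -> exists2 C, 0 <= C &
  forall x, `|x| ^+ k * normal_pdf 0 s x <= C * normal_pdf 0 (2 * s) x.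
Proof.
move=> s0; have s20 : 0 < s ^+ 2 by rewrite exprn_even_gt0.
have t0 : 2 * s != 0 by rewrite mulf_neq0.
have p0 := normal_peak_gt0 t0; have q0 := normal_peak_gt0 s0.
(* The growth rate x^2 / (4 s^2) fits between the decay rates x^2 / (2 s^2) and
   x^2 / (8 s^2) of the two densities. *)
have a0 : 0 < 4 * s ^+ 2 by rewrite mulr_gt0.
pose K : R := 1 + (4 * s ^+ 2) ^+ k * k`!%:R.
have K0 : 0 <= K by rewrite addr_ge0// mulr_ge0// exprn_ge0// ltW.
exists (K * normal_peak s / normal_peak (2 * s)).
  by rewrite divr_ge0 ?mulr_ge0// ltW.
move=> x; rewrite !normal_pdfE//=.
rewrite [leRHS]mulrA divfK ?gt_eqF// mulrCA [leRHS]mulrAC mulrC ler_wpM2r// ?(ltW q0)//.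
apply: (@le_trans _ _ (K * expR (x ^+ 2 / (4 * s ^+ 2)) * normal_fun 0 s x)).
  by rewrite ler_wpM2r ?normal_fun_ge0//; exact: expr_le_expR.
rewrite -mulrA ler_wpM2l// /normal_fun -expRD ler_expR !subr0.
rewrite -[s ^+ 2 *+ 2]mulr_natr -[(2 * s) ^+ 2 *+ 2]mulr_natr exprMn !mulNr -subr_ge0.
rewrite (_ : _ - _ = x ^+ 2 / (8 * s ^+ 2)); last by field.
by rewrite divr_ge0 ?sqr_ge0// mulr_ge0// ltW.
Qed.

Lemma integrable_normal_pow s k : s != 0 ->
  mu.-integrable setT (EFin \o (fun x => normal_pdf 0 s x * x ^+ k)).
Proof.
move=> s0; have [C C0 h] := normal_pow_le k s0.
apply: (@le_integrable _ _ _ mu setT measurableT _ (fun x => C%:E * (normal_pdf 0 (2 * s) x)%:E)%E).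
- apply/measurable_EFinP; apply: measurable_funM; first exact: measurable_normal_pdf.
  exact: exprn_measurable.
- move=> x _; rewrite -EFinM /= lee_fin normrM normrX mulrC.
  rewrite (ger0_norm (normal_pdf_ge0 _ _ _)) [leRHS]ger0_norm; first exact: h.
  by rewrite mulr_ge0// normal_pdf_ge0.
- by apply: integrableZl => //; exact: integrable_normal_pdf.
Qed.

Lemma normal_moment_integrable s k : s != 0 ->
  (normal_prob 0 s).-integrable setT (EFin \o (fun x => x ^+ k)) /\
  \int[normal_prob 0 s]_x x ^+ k = \int[mu]_x (normal_pdf 0 s x * x ^+ k).
Proof.
move=> s0; refine (@Rintegral_density _ _ _ _ _ mu (normal_prob 0 s) idfun setT
  (normal_pdf 0 s) _ _ _ _ _ (fun x => x ^+ k) _ _) => //.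
- by move=> _ B mB; rewrite setTI.
- exact: measurable_normal_pdf.
- by move=> x; exact: normal_pdf_ge0.
- by move=> B mB; rewrite setIT.
- exact: integrable_normal_pow.
Qed.

Lemma is_derive_normal_pdf s x : s != 0 ->
  is_derive x 1 (normal_pdf 0 s) (- (x / s ^+ 2) * normal_pdf 0 s x).
Proof.
move=> s0; pose g (x : R) := - x ^+ 2 / (s ^+ 2 *+ 2).
have -> : normal_pdf 0 s = normal_peak s \*: (expR \o g).
  by apply/funext => y; rewrite normal_pdfE// /normal_fun /g/= subr0.
have dg : is_derive x 1 g (- (x / s ^+ 2)).
  have -> : g = - (s ^+ 2 *+ 2)^-1 \*: ((@id R) ^+ 2).
    apply/funext => y; rewrite /g !fctE/=.
    by change (- y ^+ 2 / (s ^+ 2 *+ 2) = - (s ^+ 2 *+ 2)^-1 * y ^+ 2); ring.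
  apply: is_derive_eq; rewrite /GRing.scale/= expr1 mulr1 -[s ^+ 2 *+ 2]mulr_natr.
  by field.
have de := @is_derive1_comp _ expR g x _ _ (is_derive_expR _) dg.
apply: (is_derive_eq (is_deriveZ (normal_peak s) de)).
change (normal_peak s * (expR (g x) * - (x / s ^+ 2)) =
  - (x / s ^+ 2) * (normal_peak s * expR (g x))); ring.
Qed.

Lemma cvg_Rintegral_itvT (h : R -> R) : mu.-integrable setT (EFin \o h) ->
  \int[mu]_(x in `[- n%:R, n%:R]) h x @[n --> \oo] --> \int[mu]_x h x.
Proof.
move=> hi; pose hn (n : nat) := (EFin \o h) \_ `[(- n%:R : R), n%:R].
suff : (fun n => \int[mu]_x hn n x)%E @ \oo --> (\int[mu]_x (h x)%:E)%E.
  have -> : (\int[mu]_x (h x)%:E)%E = (\int[mu]_x h x)%:E.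
    by rewrite fineK//; exact: integrable_fin_num.
  move=> /fine_cvg c.
  apply: cvg_trans c; apply: near_eq_cvg; apply: nearW => n /=.
  by rewrite /Rintegral /hn -integral_mkcond.
apply: (@dominated_cvg _ _ _ mu setT measurableT _ (EFin \o h) (fun x => `|(h x)%:E|)%E) => //.
- move=> n; apply/(measurable_restrictT _ _).1 => //.
  by apply: measurable_funTS; exact: measurable_int hi.
- move=> x _; apply: cvg_near_cst; near=> n; rewrite /hn patchE mem_set//=.
  by rewrite in_itv/= -ler_norml; near: n; exact: nbhs_infty_ger.
- exact: integrable_abse.
- move=> n x _; rewrite /hn patchE; case: ifP => _ //=.
  by rewrite normr0 lee_fin.
Unshelve. all: by end_near. Qed.

(** Stein's identity for a power of x: the derivative of x^k times the density
    integrates to zero over the line. *)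
Lemma normal_moment_rec s k : s != 0 ->
  \int[normal_prob 0 s]_x x ^+ k.+1 =
  s ^+ 2 * k%:R * \int[normal_prob 0 s]_x x ^+ k.-1.
Proof.
move=> s0; have [_ ->] := normal_moment_integrable k.+1 s0.
have [_ ->] := normal_moment_integrable k.-1 s0.
pose F x := normal_pdf 0 s x * x ^+ k.
pose f x := k%:R * (normal_pdf 0 s x * x ^+ k.-1) -
  s ^- 2 * (normal_pdf 0 s x * x ^+ k.+1).
have ci j := integrable_normal_pow j s0.
have cpdf (j : nat) : continuous (fun x => normal_pdf 0 s x * x ^+ j).
  move=> x; apply: cvgM; last exact: exprn_continuous.
  exact: continuous_normal_pdf.
have cf : continuous f.
  by move=> x; apply: cvgB; apply: cvgM; [exact: cvg_cst|exact: cpdf|exact: cvg_cst|exact: cpdf].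
have dF x : is_derive x 1 F (f x).
  have dp := is_derive_normal_pdf x s0.
  have -> : F = normal_pdf 0 s * (@id R) ^+ k by apply/funext => y; rewrite !fctE.
  apply: is_derive_eq; rewrite /GRing.scale/= mulr1 !fctE/= /f.
  by rewrite (exprS x k); field.
have FTC n : \int[mu]_(x in `[- n.+1%:R, n.+1%:R]) f x = F n.+1%:R - F (- n.+1%:R).
  rewrite /Rintegral (@continuous_FTC2 _ f F)//.
  - by rewrite gtrN.
  - exact: continuous_subspaceT.
  - split=> [x _| |].
    + by have [] := dF x.
    + exact/cvg_at_right_filter/cpdf.
    + exact/cvg_at_left_filter/cpdf.
  - by move=> x _; rewrite derive1E; have [_ ->] := dF x.
have F0 : (fun n => F n.+1%:R - F (- n.+1%:R)) @ \oo --> 0.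
  have [C C0 hC] := normal_pow_le k.+1 s0.
  pose D := C * normal_peak (2 * s).
  have bF (x : R) n : `|x| = n.+1%:R -> `|F x| <= D * harmonic n.
    move=> xn; rewrite /F normrM normrX (ger0_norm (normal_pdf_ge0 _ _ _)).
    rewrite ler_pdivlMr// mulrC -[X in X * _]xn mulrCA mulrC -exprS.
    apply: le_trans (hC x) _; rewrite ler_wpM2l// normal_pdf_ub//.
    by rewrite mulf_neq0.
  apply/cvgr0Pnorm_le => e e0; near=> n.
  rewrite (le_trans (ler_normB _ _))//.
  have h1 : D * harmonic n <= e / 2.
    near: n; apply: (@cvgr_le _ _ _ _ (fun n => D * harmonic n) 0).
      rewrite -[X in _ --> X](mulr0 D); apply: cvgM; [exact: cvg_cst|exact: cvg_harmonic].
    by rewrite divr_gt0.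
  by rewrite [e]splitr lerD// (le_trans _ h1)// bF// ?normrN ger0_norm.
have fi : mu.-integrable setT (EFin \o f).
  have h := integrableB measurableT
    (integrableZl measurableT k%:R (ci k.-1)) (integrableZl measurableT (s ^- 2) (ci k.+1)).
  by apply: eq_integrable h => // x _.
have : \int[mu]_x f x = 0.
  have h := cvg_Rintegral_itvT fi.
  apply: (cvg_unique _ _ F0) => //.
  have := cvg_comp _ _ (@cvg_addnr 1) h.
  by apply: cvg_trans; apply: near_eq_cvg; apply: nearW => n /=; rewrite addn1 FTC.
have cZ a j : mu.-integrable setT (EFin \o (fun x => a * (normal_pdf 0 s x * x ^+ j))).
  by apply: eq_integrable (integrableZl measurableT a (ci j)) => // x _.
rewrite /f RintegralB// !RintegralZl// => /eqP.
rewrite subr_eq0 => /eqP h.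
apply: (@mulfI _ (s ^- 2)); first by rewrite invr_eq0 expf_neq0.
rewrite -h; field; exact: s0.
Unshelve. all: by end_near. Qed.

End normal_moments.

(** * Integration by parts for products of matrix entries *)

(** The independent Gaussian variables are the entries on and above the diagonal,
    whereas products of matrix entries involve all index pairs; key sends a pair
    to the position on or above the diagonal that holds the same entry. *)
Section wick.
Context d (T : measurableType d) (R : realType) (P : probability T R) (n : nat).
Variable A : random_symmx T R n.+1.
Hypothesis A_GOE : is_GOE P A.

Local Notation N := n.+1.
Local Notation entry := ('I_N * 'I_N)%type.
Local Notation upper := {p : entry | (p.1 <= p.2)%N}.

Let X (p : upper) w := A w (val p).1 (val p).2.

Let sorted_entry (l : entry) := if (l.1 <= l.2)%N then l else (l.2, l.1).

Let sorted_entryP l : ((sorted_entry l).1 <= (sorted_entry l).2)%N.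
Proof.
rewrite /sorted_entry; case: ifP => //= /negbT; rewrite -ltnNge; exact: ltnW.
Qed.

Let key l : upper := exist _ (sorted_entry l) (sorted_entryP l).

Let A_sym w i j : A w i j = A w j i.
Proof. by rewrite -[in LHS](symmx_sym A w) mxE. Qed.

Let X_key l w : X (key l) w = A w l.1 l.2.
Proof. by rewrite /X /= /sorted_entry; case: leqP => //= _; exact: A_sym. Qed.

Let key_eq l m : (key m == key l) = (l == m) || (l == (m.2, m.1)).
Proof.
rewrite -val_eqE/= /sorted_entry; case: l m => [i j] [a b] /=.
by case: (leqP i j) => ij; case: (leqP a b) => ab; rewrite /= !xpair_eqE -!val_eqE/=; lia.
Qed.

(** N times the covariance of two entries; for a diagonal entry both terms equal
    one, which accounts for the double variance. *)
Definition covariance_entry (l m : entry) : R :=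
  (l == m)%:R + (l == (m.2, m.1))%:R.

Let var (p : upper) : R := if (val p).1 == (val p).2 then 2 / N%:R else 1 / N%:R.

Let covE l m : covariance_entry l m = (key m == key l)%:R * (N%:R * var (key l)).
Proof.
have N0 : N%:R != 0 :> R by [].
have -> : N%:R * var (key l) = if l.1 == l.2 then 2 else 1.
  rewrite /var /= /sorted_entry; case: leqP => _ /=; last rewrite eq_sym.
    by case: ifP => _; field.
  by case: ifP => _; field.
rewrite key_eq /covariance_entry; case: l m => [i j] [a b] /=; rewrite !xpair_eqE.
have [->|ij] := eqVneq i j.
  by rewrite andbC; case: (_ && _) => /=; rewrite ?mul1r ?mul0r ?addr0// -natrD.
have [ia|ia] := eqVneq i a; have [jb|jb] := eqVneq j b;
  have [ib|ib] := eqVneq i b; have [ja|ja] := eqVneq j a;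
  rewrite /= ?addr0 ?add0r ?mul1r ?mul0r//.
by move: ij; rewrite ib jb eqxx.
Qed.

Let mX p : measurable_fun setT (X p).
Proof. exact: symmx_measurable. Qed.

Let sd (p : upper) : R := Num.sqrt (if (val p).1 == (val p).2 then 2 / N%:R else 1 / N%:R).

Let sd_sqr p : sd p ^+ 2 = var p.
Proof. by rewrite sqr_sqrtr//; case: ifP => _; rewrite divr_ge0. Qed.

Let sd_neq0 p : sd p != 0.
Proof. by rewrite gt_eqF// sqrtr_gt0; case: ifP => _; rewrite divr_gt0. Qed.

Let moment p k := \int[P]_w X p w ^+ k.

Let X_moment p k : P.-integrable setT (EFin \o (fun w => X p w ^+ k)) /\
  moment p k = \int[normal_prob 0 (sd p)]_x x ^+ k.
Proof.
have [ik _] := normal_moment_integrable k (sd_neq0 p).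
have KE (g : R -> R) : (fun w => 1 * \sum_(x <- [:: X p w]) g x) = g \o X p.
  by apply/funext => w; rewrite mul1r big_seq1.
have mXB (B : set R) : measurable B -> measurable (X p @^-1` B).
  by move=> mB; rewrite -[Y in measurable Y]setTI; exact: mX.
have KB (B : set R) : (\1_B : R -> R) \o X p = \1_(X p @^-1` B) :> (T -> R).
  by apply/funext => w; rewrite /= !indicE; congr (_%:R); apply/idP/idP; rewrite !inE.
have [|||] := @Rintegral_mixture _ _ _ _ _ P (normal_prob 0 (sd p))
  (fun w => [:: X p w]) (fun=> 1) _ _ _ _ ik.
- by [].
- by move=> B mB; rewrite KE KB; apply: measurable_indic; exact: mXB.
- move=> B mB; transitivity (P (X p @^-1` B)).
    exact: (esym (GOE_gaussian A_GOE (valP p) mB)).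
  rewrite (_ : (fun w => _) = EFin \o \1_(X p @^-1` B)).
    by rewrite integral_indic ?setIT//; exact: mXB.
  by rewrite -KB -KE.
- by rewrite KE /moment => i ->.
Qed.

Let moment_rec p k : moment p k.+1 = var p * k%:R * moment p k.-1.
Proof.
have [_ ->] := X_moment p k.+1; have [_ ->] := X_moment p k.-1.
by rewrite normal_moment_rec ?sd_neq0// sd_sqr.
Qed.

Definition entries_prod (L : seq entry) w := \prod_(l <- L) A w l.1 l.2.

Let others p (L : seq entry) w := \prod_(l <- L | key l != p) A w l.1 l.2.

Let cnt p (L : seq entry) := count (fun l => key l == p) L.

Let entries_prod_split p L w : entries_prod L w = X p w ^+ cnt p L * others p L w.
Proof.
rewrite /entries_prod (bigID (fun l => key l == p))/=; congr (_ * _).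
rewrite (eq_bigr (fun=> X p w)); last by move=> l /eqP <-; rewrite X_key.
by rewrite big_const_seq iter_mulr mulr1.
Qed.

Let others_split p L w : others p L w = \prod_(q | q != p) X q w ^+ cnt q L.
Proof.
rewrite /others (partition_big key (fun q => q != p))//=.
apply: eq_bigr => q qp; rewrite (eq_bigl (fun l => key l == q)); last first.
  by move=> l; case: (key l =P q) => [->|_]; rewrite ?qp ?andbF.
rewrite (eq_bigr (fun=> X q w)); last by move=> l /eqP <-; rewrite X_key.
by rewrite big_const_seq iter_mulr mulr1.
Qed.

Let expectation_split p k L :
  P.-integrable setT (EFin \o (fun w => X p w ^+ k * others p L w)) /\
  \int[P]_w (X p w ^+ k * others p L w) =
  moment p k * \prod_(q | q != p) moment q (cnt q L).
Proof.
pose e q := if q == p then k else cnt q L.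
have [||i E] := @independent_prod _ _ _ P _ X mX (GOE_independent A_GOE)
   (fun q x => x ^+ e q).
- by move=> q; exact: exprn_measurable.
- by move=> q; have [] := X_moment q (e q).
have h w : \prod_q X q w ^+ e q = X p w ^+ k * others p L w.
  rewrite (bigD1 p)//= /e eqxx others_split; congr (_ * _).
  by apply: eq_bigr => q /negPf ->.
rewrite (_ : (fun w => _) = fun w => \prod_q X q w ^+ e q); last first.
  by apply/funext => w; rewrite h.
split; first exact: i.
rewrite E (bigD1 p)//= /e eqxx; congr (_ * _).
by apply: eq_bigr => q /negPf ->.
Qed.

Lemma integrable_entries_prod L : P.-integrable setT (EFin \o entries_prod L).
Proof.
have [+ _] := expectation_split (key (ord0, ord0)) (cnt (key (ord0, ord0)) L) L.
apply: eq_integrable => // w _.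
by rewrite /= -entries_prod_split.
Qed.

(** The derivation D_l applied to the product of the entries in L, by the Leibniz
    rule. *)
Fixpoint entries_deriv (l : entry) (L : seq entry) w : R :=
  if L is m :: L' then
    covariance_entry l m * entries_prod L' w + A w m.1 m.2 * entries_deriv l L' w
  else 0.

Let entries_derivE l L w : entries_deriv l L w =
  N%:R * var (key l) * (cnt (key l) L)%:R *
  (X (key l) w ^+ (cnt (key l) L).-1 * others (key l) L w).
Proof.
elim: L => [|m L IH] /=; first by rewrite mulr0 mul0r.
rewrite IH covE (entries_prod_split (key l)) /others big_cons -/(others _ _ _).
have [ml|ml] /= := eqVneq (key m) (key l).
  rewrite add1n /= mul1r -(X_key m) ml -(@natr1 R).
  case: (cnt _ _) => [|c] /=; first by rewrite expr0; ring.
  by rewrite exprS; ring.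
by rewrite add0n; ring.
Qed.

(** Integration by parts in the single variable X (key (i, j)): its exponent in
    the product drops by one through the moment recursion, and independence
    factors out the other variables. *)
Lemma gaussian_ibp_entries i j L :
  \int[P]_w (A w i j * entries_prod L w) =
  N%:R^-1 * \int[P]_w entries_deriv (i, j) L w.
Proof.
pose p := key (i, j); pose c := cnt p L.
have lhs w : A w i j * entries_prod L w = X p w ^+ c.+1 * others p L w.
  by rewrite (entries_prod_split p) exprS mulrA -(X_key (i, j)).
under eq_Rintegral do rewrite lhs; under [in RHS]eq_Rintegral do rewrite entries_derivE.
have [i1 E1] := expectation_split p c.+1 L.
have [i2 E2] := expectation_split p c.-1 L.
rewrite RintegralZl// E1 E2 moment_rec -/p -/c.
by rewrite -!mulrA mulKf.
Qed.

End wick.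

(** * Large-N limit of the loop equations *)

Section loop_equations.
Variable R : realType.

(** A list of exponents stands for the product of the traces of the powers.  When
    D_ij hits the factor tr(A^k), contracting with (A^n)_ji merges the two into
    2k tr(A^(n+k-1)); the merged products are listed with their coefficients.
    For n = k = 0 the truncated exponent is harmless, the coefficient being 0. *)
Fixpoint merge_exponents (n : nat) (L : seq nat) : seq (R * seq nat) :=
  if L is k :: L' then
    ((2 * k)%:R, (n + k).-1 :: L') ::
      [seq (r.1, k :: r.2) | r <- merge_exponents n L']
  else [::].

Lemma merge_exponents_weight n L r : r \in merge_exponents n L ->
  (sumn r.2 < n.+1 + sumn L)%N.
Proof.
elim: L r => //= k L IH r; rewrite inE => /predU1P[->/=|/mapP[r' r'L ->/=]].
  by lia.
by have := IH _ r'L; lia.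
Qed.

(** Each product on the right-hand side of the loop equation has a smaller sum of
    exponents, hence a limit by induction, and the factors 1/N kill all terms but
    the convolution.  The inner induction on the list removes zero exponents,
    which leave the sum unchanged. *)
Lemma loop_equation_limit (e : nat -> seq nat -> R) (c : nat -> R) :
  (forall N, e N [::] = 1) ->
  (forall N L, e N (0%N :: L) = e N L) ->
  (forall N n L, e N (n.+1 :: L) =
     \sum_(a < n) e N [:: val a, (n.-1 - a)%N & L] +
     n%:R / N.+1%:R * e N (n.-1 :: L) +
     N.+1%:R ^- 2 * \sum_(r <- merge_exponents n L) r.1 * e N r.2) ->
  c 0 = 1 -> (forall n, c n.+1 = \sum_(a < n) c a * c (n.-1 - a)%N) ->
  forall L, e ^~ L @ \oo --> \prod_(k <- L) c k.
Proof.
move=> e_nil e_0 e_S c0 cS L.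
have [m] := ubnP (sumn L); elim: m L => // m IHm L; rewrite ltnS.
elim: L => [|k L IHL] Lm.
  rewrite big_nil (_ : e ^~ [::] = fun=> 1); first exact: cvg_cst.
  by apply/funext => N.
case: k Lm => [|n] Lm.
  rewrite big_cons c0 mul1r (_ : e ^~ (_ :: _) = e ^~ L); first exact: IHL.
  by apply/funext => N.
rewrite (_ : e ^~ (_ :: _) = fun N =>
     \sum_(a < n) e N [:: val a, (n.-1 - a)%N & L] +
     n%:R / N.+1%:R * e N (n.-1 :: L) +
     N.+1%:R ^- 2 * \sum_(r <- merge_exponents n L) r.1 * e N r.2); last first.
  by apply/funext => N; exact: e_S.
have cvgV : (fun N => N.+1%:R^-1 : R) @ \oo --> (0 : R) by exact: cvg_harmonic.
have -> : \prod_(k <- n.+1 :: L) c k =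
    \sum_(a < n) c a * c (n.-1 - a)%N * \prod_(k <- L) c k +
    n%:R * 0 * \prod_(k <- n.-1 :: L) c k +
    0 * 0 * \sum_(r <- merge_exponents n L) r.1 * \prod_(k <- r.2) c k.
  by rewrite big_cons cS mulr0 !mul0r !addr0 mulr_suml.
apply: cvgD; first apply: cvgD.
- apply: cvg_big => [|a _]; first exact: add_continuous.
  have := IHm [:: val a, (n.-1 - a)%N & L].
  rewrite !big_cons mulrA; apply; move: Lm (ltn_ord a) => /=; lia.
- apply: cvgM; first by apply: cvgM; [exact: cvg_cst|exact: cvgV].
  by apply: IHm; move: Lm => /=; lia.
- apply: cvgM.
    rewrite (_ : (fun N => _) = fun N : nat => N.+1%:R^-1 * N.+1%:R^-1); last first.
      by apply/funext => N; rewrite -exprVn expr2.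
    by apply: cvgM; exact: cvgV.
  rewrite big_seq; under eq_fun do rewrite big_seq.
  apply: cvg_big => [|r rL]; first exact: add_continuous.
  apply: cvgM; first exact: cvg_cst.
  by apply: IHm; have := merge_exponents_weight rL; move: Lm => /=; lia.
Qed.

End loop_equations.

(** * Loop equations for products of traces *)

Section trace_ibp.
Context d (T : measurableType d) (R : realType) (P : probability T R) (n : nat).
Variable A : random_symmx T R n.+1.
Hypothesis A_GOE : is_GOE P A.

Local Notation N := n.+1.
Local Notation entry := ('I_N * 'I_N)%type.

(** F is a polynomial in the entries of A and DF l its derivative D_l F.  Relating
    functions of w, rather than formal polynomials, lets powers and traces of A
    enter through closure properties. *)
Inductive entry_deriv : (T -> R) -> (entry -> T -> R) -> Prop :=
| entry_deriv_prod L :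
    entry_deriv (entries_prod A L) (fun l => entries_deriv A l L)
| entry_deriv_lin c F DF G DG : entry_deriv F DF -> entry_deriv G DG ->
    entry_deriv (fun w => c * F w + G w) (fun l w => c * DF l w + DG l w).

Let entry_deriv_eq F DF G DG : entry_deriv F DF -> F =1 G ->
  (forall l, DF l =1 DG l) -> entry_deriv G DG.
Proof.
move=> + /funext <- DE; suff -> : DF = DG by [].
by apply/funext => l; apply/funext => w; exact: DE.
Qed.

Let entry_deriv0 : entry_deriv (fun=> 0) (fun _ _ => 0).
Proof.
apply: entry_deriv_eq (entry_deriv_lin (-1) (entry_deriv_prod [::]) (entry_deriv_prod [::])) _ _.
  by move=> w; ring.
by move=> l w; ring.
Qed.

Let entry_deriv_cst c : entry_deriv (fun=> c) (fun _ _ => 0).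
Proof.
apply: entry_deriv_eq (entry_deriv_lin c (entry_deriv_prod [::]) entry_deriv0) _ _.
  by move=> w; rewrite /entries_prod big_nil; ring.
by move=> l w /=; ring.
Qed.

Let entry_derivD F DF G DG : entry_deriv F DF -> entry_deriv G DG ->
  entry_deriv (fun w => F w + G w) (fun l w => DF l w + DG l w).
Proof.
move=> dF dG; apply: entry_deriv_eq (entry_deriv_lin 1 dF dG) _ _.
  by move=> w; ring.
by move=> l w; ring.
Qed.

Let entry_deriv_sum (J : Type) (s : seq J) F DF :
  (forall j : J, entry_deriv (F j) (DF j)) ->
  entry_deriv (fun w => \sum_(j <- s) F j w) (fun l w => \sum_(j <- s) DF j l w).
Proof.
move=> dF; elim: s => [|j s IH].
  by apply: entry_deriv_eq entry_deriv0 _ _ => [w|l w]; rewrite big_nil.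
by apply: entry_deriv_eq (entry_derivD (dF j) IH) _ _ => [w|l w]; rewrite big_cons.
Qed.

Let entry_deriv_entryM m F DF : entry_deriv F DF ->
  entry_deriv (fun w => A w m.1 m.2 * F w)
    (fun l w => covariance_entry R l m * F w + A w m.1 m.2 * DF l w).
Proof.
elim=> [L|c {}F {}DF G DG dF IF dG IG].
  apply: entry_deriv_eq (entry_deriv_prod (m :: L)) _ _ => // w.
  by rewrite /entries_prod big_cons.
apply: entry_deriv_eq (entry_deriv_lin c IF IG) _ _ => [w|l w]; ring.
Qed.

Let entry_derivM F DF G DG : entry_deriv F DF -> entry_deriv G DG ->
  entry_deriv (fun w => F w * G w) (fun l w => DF l w * G w + F w * DG l w).
Proof.
move=> dF; elim: dF G DG => [L|c {}F {}DF F' DF' dF IF dF' IF'] G DG dG; last first.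
  apply: entry_deriv_eq (entry_deriv_lin c (IF _ _ dG) (IF' _ _ dG)) _ _ => [w|l w]; ring.
elim: L => [|m L IH].
  apply: entry_deriv_eq dG _ _ => [w|l w] /=; rewrite /entries_prod big_nil; ring.
apply: entry_deriv_eq (entry_deriv_entryM m IH) _ _ => [w|l w] /=;
  rewrite /entries_prod ?big_cons; ring.
Qed.

Let integrable_entries_derivM l L M :
  P.-integrable setT (EFin \o (fun w => entries_deriv A l L w * entries_prod A M w)).
Proof.
elim: L M => [|m L IH] M /=.
  by apply: eq_integrable (integrable0 _ _) => // w _; rewrite /= mul0r.
apply: eq_integrable (integrableD measurableT
  (integrableZl measurableT (covariance_entry R l m) (integrable_entries_prod A_GOE (L ++ M)))
  (IH (m :: M))) => // w _.
rewrite /= -EFinM -EFinD; congr (_%:E).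
by rewrite /entries_prod big_cat/= big_cons; ring.
Qed.

Let integrable_entries_deriv l L : P.-integrable setT (EFin \o entries_deriv A l L).
Proof.
apply: eq_integrable (integrable_entries_derivM l L [::]) => // w _.
by rewrite /= /entries_prod big_nil mulr1.
Qed.

Let integrable_lin c F G : P.-integrable setT (EFin \o F) ->
  P.-integrable setT (EFin \o G) -> P.-integrable setT (EFin \o (fun w => c * F w + G w)).
Proof.
move=> iF iG.
by apply: eq_integrable (integrableD measurableT (integrableZl measurableT c iF) iG).
Qed.

Let Rintegral_lin c F G : P.-integrable setT (EFin \o F) ->
  P.-integrable setT (EFin \o G) ->
  \int[P]_w (c * F w + G w) = c * \int[P]_w F w + \int[P]_w G w.
Proof.
move=> iF iG; rewrite RintegralD ?RintegralZl//.
by apply: eq_integrable (integrableZl measurableT c iF).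
Qed.

Let entry_deriv_integrable F DF : entry_deriv F DF ->
  P.-integrable setT (EFin \o F) /\ forall l, P.-integrable setT (EFin \o DF l).
Proof.
elim=> [L|c {}F {}DF G DG dF [IF IDF] dG [IG IDG]].
  by split => [|l]; [exact: integrable_entries_prod|exact: integrable_entries_deriv].
by split => [|l]; exact: integrable_lin.
Qed.

Lemma gaussian_ibp F DF i j : entry_deriv F DF ->
  P.-integrable setT (EFin \o (fun w => A w i j * F w)) /\
  \int[P]_w (A w i j * F w) = N%:R^-1 * \int[P]_w DF (i, j) w.
Proof.
move=> dF; split; first by have [] := entry_deriv_integrable (entry_deriv_entryM (i, j) dF).
elim: dF => [L|c {}F {}DF G DG dF IF dG IG]; first exact: gaussian_ibp_entries.
have [aF _] := entry_deriv_integrable (entry_deriv_entryM (i, j) dF).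
have [aG _] := entry_deriv_integrable (entry_deriv_entryM (i, j) dG).
have [_ iDF] := entry_deriv_integrable dF.
have [_ iDG] := entry_deriv_integrable dG.
rewrite (Rintegral_lin _ (iDF _) (iDG _)) mulrDr mulrCA -IF -IG -Rintegral_lin//.
by apply: eq_Rintegral => w _; ring.
Qed.

Let pow w k := A w ^+ k.

Let powS w k p q : pow w k.+1 p q = \sum_r A w p r * pow w k r q.
Proof. by rewrite /pow exprS -mulmxE mxE. Qed.

(** D_l of (A^k)_pq by the Leibniz rule for a product of k matrices. *)
Let deriv_pow k p q (l : entry) w :=
  \sum_(a < k) (pow w a p l.1 * pow w (k.-1 - a) l.2 q +
                pow w a p l.2 * pow w (k.-1 - a) l.1 q).

Let entry_deriv_pow k p q :
  entry_deriv (fun w => pow w k p q) (deriv_pow k p q).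
Proof.
elim: k p q => [|k IH] p q.
  apply: entry_deriv_eq (entry_deriv_cst ((1%:M : 'M[R]_N) p q)) _ _ => // l w.
  by rewrite /deriv_pow big_ord0.
apply: entry_deriv_eq (entry_deriv_sum (index_enum 'I_N)
  (fun r => entry_deriv_entryM (p, r) (IH r q))) _ _ => [w|l w] /=.
  by rewrite powS.
rewrite big_split/= /deriv_pow [RHS]big_ord_recl/= subn0; congr (_ + _).
  have pow0 a b : pow w 0 a b = (a == b)%:R by rewrite /pow expr0 mxE.
  rewrite !pow0 /covariance_entry; case: l => i j /=.
  under eq_bigr do rewrite !xpair_eqE mulrDl.
  rewrite big_split/=; congr (_ + _).
    rewrite (bigD1 j)//= eqxx andbT [i == p]eq_sym big1 ?addr0// => r rj.
    by rewrite [j == r]eq_sym (negPf rj) andbF mul0r.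
  rewrite (bigD1 i)//= eqxx [j == p]eq_sym big1 ?addr0// => r ri.
  by rewrite [i == r]eq_sym (negPf ri) mul0r.
under eq_bigr do rewrite mulr_sumr.
rewrite exchange_big/=; apply: eq_bigr => a _.
rewrite /bump/= add1n.
under eq_bigr do rewrite mulrDr !mulrA.
rewrite big_split/= -!mulr_suml -!powS.
by rewrite (_ : (k - a.+1 = k.-1 - a)%N)//; lia.
Qed.

Let tr w k := \tr (A w ^+ k).

Let pow_sym w k i j : pow w k i j = pow w k j i.
Proof.
have : (A w ^+ k)^T = A w ^+ k.
  elim: k => [|k IH]; first by rewrite expr0 trmx1.
  by rewrite exprS -mulmxE trmx_mul IH (symmx_sym A w) mulmxE -exprSr exprS.
by move=> /matrixP/(_ j i); rewrite mxE.
Qed.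

Let powD w a b i j : \sum_p pow w a i p * pow w b p j = pow w (a + b) i j.
Proof. by rewrite /pow exprD -mulmxE mxE. Qed.

Let entry_deriv_tr k :
  entry_deriv (fun w => tr w k) (fun l w => (2 * k)%:R * pow w k.-1 l.1 l.2).
Proof.
apply: entry_deriv_eq (entry_deriv_sum (index_enum 'I_N)
  (fun p => entry_deriv_pow k p p)) _ _ => // -[i j] w /=.
rewrite /deriv_pow exchange_big/=.
transitivity (\sum_(a < k) 2 * pow w k.-1 i j).
  apply: eq_bigr => a _; rewrite big_split/=.
  have ak : (k.-1 - a + a = k.-1)%N by have := ltn_ord a; lia.
  under eq_bigr do rewrite mulrC.
  rewrite powD ak; under eq_bigr do rewrite mulrC.
  by rewrite powD ak [pow w k.-1 j i]pow_sym; ring.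
by rewrite sumr_const card_ord -mulr_natl natrM; ring.
Qed.

Let trs (L : seq nat) w := \prod_(k <- L) tr w k.

Fixpoint deriv_trs L (l : entry) w : R :=
  if L is k :: L' then
    (2 * k)%:R * pow w k.-1 l.1 l.2 * trs L' w + tr w k * deriv_trs L' l w
  else 0.

Let entry_deriv_trs L : entry_deriv (trs L) (deriv_trs L).
Proof.
elim: L => [|k L IH].
  by apply: entry_deriv_eq (entry_deriv_cst 1) _ _ => [w|l w]; rewrite /trs ?big_nil.
apply: entry_deriv_eq (entry_derivM (entry_deriv_tr k) IH) _ _ => // w.
by rewrite /trs big_cons.
Qed.

Let trE w k : tr w k = \sum_i pow w k i i.
Proof. by []. Qed.

Let contract_deriv_trs k L w :
  \sum_(l : entry) pow w k l.2 l.1 * deriv_trs L l w =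
  \sum_(r <- merge_exponents R k L) r.1 * trs r.2 w.
Proof.
elim: L => [|m L IH] /=.
  by rewrite big_nil big1// => l _; rewrite mulr0.
rewrite big_cons big_map/=.
under [in RHS]eq_bigr do rewrite /trs big_cons mulrCA.
rewrite -mulr_sumr -IH mulr_sumr {2}/trs big_cons.
under eq_bigr do rewrite mulrDr.
rewrite big_split/=; congr (_ + _); last by apply: eq_bigr => l _; rewrite mulrCA.
rewrite -(pair_bigA _ (fun i j => pow w k j i * ((2 * m)%:R * pow w m.-1 i j * trs L w)))/=.
rewrite mulrA trE mulr_sumr mulr_suml exchange_big/=; apply: eq_bigr => j _.
case: m => [|m]; first by rewrite muln0 !mul0r big1// => i _; rewrite !mul0r mulr0.
rewrite addnS /= -powD mulr_sumr mulr_suml; apply: eq_bigr => i _.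
by rewrite -/(trs L w); ring.
Qed.

Let contract_deriv_pow k w :
  \sum_(l : entry) deriv_pow k l.2 l.1 l w =
  k%:R * tr w k.-1 + \sum_(a < k) tr w a * tr w (k.-1 - a).
Proof.
rewrite /deriv_pow exchange_big/=.
transitivity (\sum_(a < k) (tr w k.-1 + tr w a * tr w (k.-1 - a))); last first.
  by rewrite big_split/= sumr_const card_ord -[tr w k.-1 *+ k]mulr_natl.
apply: eq_bigr => a _; rewrite big_split/=; congr (_ + _).
  rewrite -(pair_bigA _ (fun i j => pow w a j i * pow w (k.-1 - a) j i))/=.
  rewrite exchange_big/= trE; apply: eq_bigr => j _.
  under eq_bigr do rewrite [pow w (_ - _) j _]pow_sym.
  by rewrite powD subnKC//; have := ltn_ord a; lia.
rewrite -(pair_bigA _ (fun i j => pow w a j j * pow w (k.-1 - a) i i))/= exchange_big/=.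
by rewrite !trE mulr_suml; apply: eq_bigr => j _; rewrite mulr_sumr.
Qed.

Lemma integrable_traces L :
  P.-integrable setT (EFin \o (fun w => \prod_(k <- L) \tr (A w ^+ k))).
Proof. by have [] := entry_deriv_integrable (entry_deriv_trs L). Qed.

Let EtrZ (c : R) L : P.-integrable setT (EFin \o (fun w => c * trs L w)) /\
  \int[P]_w (c * trs L w) = c * \int[P]_w trs L w.
Proof.
have iL := integrable_traces L.
split; last by rewrite RintegralZl.
by apply: eq_integrable (integrableZl measurableT c iL).
Qed.

(** Integration by parts in tr(A^(k+1)) Q = sum_ij a_ij (A^k)_ji Q. *)
Let loop_trs k L :
  \int[P]_w trs (k.+1 :: L) w = N%:R^-1 * (
    k%:R * \int[P]_w trs (k.-1 :: L) w +
    \sum_(a < k) \int[P]_w trs [:: val a, (k.-1 - a)%N & L] w +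
    \sum_(r <- merge_exponents R k L) r.1 * \int[P]_w trs r.2 w).
Proof.
pose F (l : entry) w := pow w k l.2 l.1 * trs L w.
pose DF (l : entry) l' w := deriv_pow k l.2 l.1 l' w * trs L w +
  pow w k l.2 l.1 * deriv_trs L l' w.
have dF l : entry_deriv (F l) (DF l).
  exact: entry_derivM (entry_deriv_pow _ _ _) (entry_deriv_trs L).
have lhs w : trs (k.+1 :: L) w = \sum_(l : entry) A w l.1 l.2 * F l w.
  rewrite /trs big_cons -(pair_bigA _ (fun i j => A w i j * F (i, j) w))/=.
  rewrite trE mulr_suml; apply: eq_bigr => i _; rewrite powS mulr_suml.
  by apply: eq_bigr => j _; rewrite /F mulrA.
under eq_Rintegral do rewrite lhs.
have iF l : P.-integrable setT (EFin \o (fun w => A w l.1 l.2 * F l w)).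
  by have [] := gaussian_ibp l.1 l.2 (dF l).
have [_ ->] := Rintegral_sum (index_enum entry) iF.
have iD l : P.-integrable setT (EFin \o DF l l).
  by have [_] := entry_deriv_integrable (dF l).
transitivity (N%:R^-1 * \int[P]_w \sum_(l : entry) DF l l w).
  have [_ ->] := Rintegral_sum (index_enum entry) iD.
  rewrite mulr_sumr; apply: eq_bigr => l _.
  by have [_ ->] := gaussian_ibp l.1 l.2 (dF l); rewrite -surjective_pairing.
congr (_ * _).
have i1 := proj1 (EtrZ k%:R (k.-1 :: L)).
have [i2 E2] := Rintegral_sum (index_enum 'I_k)
  (fun a => integrable_traces [:: val a, (k.-1 - a)%N & L]).
have [i3 E3] := Rintegral_sum (merge_exponents R k L) (fun r => proj1 (EtrZ r.1 r.2)).
have i12 : P.-integrable setT (EFin \o (fun w => k%:R * trs (k.-1 :: L) w +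
    \sum_(a < k) trs [:: val a, (k.-1 - a)%N & L] w)).
  by apply: eq_integrable (integrableD measurableT i1 i2).
rewrite -(proj2 (EtrZ _ _)) -E2.
under [X in _ = _ + X]eq_bigr do rewrite -(proj2 (EtrZ _ _)).
rewrite -E3 -RintegralD// -RintegralD//.
apply: eq_Rintegral => w _.
rewrite /DF big_split/= -mulr_suml contract_deriv_pow contract_deriv_trs.
congr (_ + _); rewrite mulrDl -mulrA; congr (_ + _).
  by rewrite /trs big_cons.
by rewrite mulr_suml; apply: eq_bigr => a _; rewrite /trs !big_cons mulrA.
Qed.

Definition mean_traces (L : seq nat) : R :=
  \int[P]_w \prod_(k <- L) (\tr (A w ^+ k) / N%:R).

Let mean_tracesE L : mean_traces L = N%:R ^- size L * \int[P]_w trs L w.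
Proof.
rewrite -(proj2 (EtrZ _ _)); apply: eq_Rintegral => w _.
rewrite /trs; elim: L => [|k L IH]; first by rewrite !big_nil expr0 invr1 mulr1.
by rewrite !big_cons IH /= exprS invfM /tr; ring.
Qed.

Lemma mean_traces_nil : mean_traces [::] = 1.
Proof.
rewrite /mean_traces; under eq_Rintegral do rewrite big_nil.
rewrite Rintegral_cst// mul1r.
exact: (congr1 fine (@probability_setT _ _ _ P)).
Qed.

Lemma mean_traces0 L : mean_traces (0%N :: L) = mean_traces L.
Proof.
apply: eq_Rintegral => w _; rewrite big_cons expr0 mxtrace1 divff ?mul1r//.
Qed.

(** The term of order 1/N comes from the symmetry of A (a_ij and a_ji coincide),
    the one of order 1/N^2 from differentiating the factors in L. *)
Lemma mean_traces_loop k L : mean_traces (k.+1 :: L) =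
  \sum_(a < k) mean_traces [:: val a, (k.-1 - a)%N & L] +
  k%:R / N%:R * mean_traces (k.-1 :: L) +
  N%:R ^- 2 * \sum_(r <- merge_exponents R k L) r.1 * mean_traces r.2.
Proof.
have N0 : N%:R != 0 :> R by [].
have size_merge r : r \in merge_exponents R k L -> size r.2 = size L.
  elim: L r => //= m L IH r; rewrite inE => /predU1P[->//|/mapP[r' r'L ->/=]].
  by rewrite IH.
have -> : \sum_(a < k) mean_traces [:: val a, (k.-1 - a)%N & L] =
    N%:R ^- (size L).+2 *
    \sum_(a < k) \int[P]_w trs [:: val a, (k.-1 - a)%N & L] w.
  by rewrite mulr_sumr; apply: eq_bigr => a _; rewrite mean_tracesE.
have -> : \sum_(r <- merge_exponents R k L) r.1 * mean_traces r.2 =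
   N%:R ^- size L * \sum_(r <- merge_exponents R k L) r.1 * \int[P]_w trs r.2 w.
  rewrite mulr_sumr !big_seq; apply: eq_bigr => r rL.
  by rewrite mean_tracesE size_merge// mulrCA.
rewrite !mean_tracesE loop_trs/= !exprS expr0 mulr1; 
move: (N%:R ^+ size L) (expf_neq0 (size L) N0) => q q0.
move: (N%:R : R) N0 => x x0.
by field; rewrite x0 q0.
Qed.

End trace_ibp.

(** * Moments of the averaged eigenvalue distribution *)

Section averaged_esd_moments.
Context d (T : measurableType d) (R : realType) (P : probability T R) (n : nat).
Variable A : random_symmx T R n.+1.
Hypothesis A_GOE : is_GOE P A.

Let trace_eigenvalues k w : \tr (A w ^+ k) = \sum_(x <- eigenvalues (A w)) x ^+ k.
Proof.
have [s sA [_ ->]] := symmetric_split (symmx_sym A w).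
exact/esym/perm_big/perm_eigenvalues.
Qed.

(** The trace of A^k is the k-th power sum of the eigenvalues.  Odd powers are
    integrable because |x|^k <= 1 + x^(2k). *)
Lemma averaged_esd_moment k :
  (averaged_esd P A : {measure set R -> \bar R}).-integrable setT
    (EFin \o (fun x => x ^+ k)) /\
  \int[averaged_esd P A]_x x ^+ k = mean_traces P A [:: k].
Proof.
pose c := fun _ : T => n.+1%:R^-1 : R.
have c0 w : 0 <= c w by rewrite invr_ge0.
have mK (B : set R) : measurable B -> measurable_fun setT
    (fun w => c w * \sum_(x <- eigenvalues (A w)) \1_B x).
  move=> mB; apply: measurable_funM => //.
    exact: measurable_cst.
  exact: measurable_lstat_indic.
have muK (B : set R) : measurable B -> averaged_esd P A B =
    (\int[P]_w (c w * \sum_(x <- eigenvalues (A w)) \1_B x)%:E)%E.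
  move=> mB; apply: eq_integral => w _.
  by rewrite /esd EFinM -sumEFin.
have KE j w : c w * \sum_(x <- eigenvalues (A w)) x ^+ j =
    \prod_(i <- [:: j]) (\tr (A w ^+ i) / n.+1%:R).
  by rewrite big_seq1 trace_eigenvalues mulrC.
have even_int j : (averaged_esd P A : {measure set R -> \bar R}).-integrable setT
    (EFin \o (fun x => x ^+ (2 * j))).
  apply: (integrable_mixture c0 mK muK); first exact: exprn_measurable.
  have i := integrable_traces A_GOE [:: (2 * j)%N].
  apply: le_lt_trans (integrable_lty measurableT (integrableZl measurableT n.+1%:R^-1 i)).
  rewrite le_eqVlt; apply/orP; left; apply/eqP; apply: eq_integral => w _.
  rewrite /= -EFinM big_seq1 trace_eigenvalues; congr (_ * _)%:E.
  by apply: eq_bigr => x _; rewrite ger0_norm// exprM exprn_ge0// sqr_ge0.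
have ki : (averaged_esd P A : {measure set R -> \bar R}).-integrable setT
    (EFin \o (fun x => x ^+ k)).
  apply: (le_integrable measurableT _ _ (integrableD measurableT (even_int 0) (even_int k))).
    by apply/measurable_EFinP; exact: exprn_measurable.
  move=> x _; rewrite /= lee_fin muln0 expr0.
  have x2 : 0 <= x ^+ (2 * k) by rewrite exprM exprn_ge0// sqr_ge0.
  rewrite [leRHS]ger0_norm ?addr_ge0// normrX.
  have [x1|x1] := leP `|x| 1.
    by rewrite (le_trans (exprn_ile1 _ (normr_ge0 x) x1))// lerDl.
  apply: (@le_trans _ _ (`|x| ^+ (2 * k))).
    by rewrite ler_weXn2l ?(ltW x1)// leq_pmull.
  by rewrite !exprM real_normK ?num_real// lerDr.
split=> //.
have [_ ->] := Rintegral_mixture c0 mK muK ki.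
by apply: eq_Rintegral => w _; rewrite KE.
Qed.

End averaged_esd_moments.

(** * Moments of the semicircle distribution *)

Section catalan.
Variable R : realType.

(** The two-term recursion of the aerated Catalan numbers (c at 2m is the m-th
    Catalan number) implies their convolution recursion.  Multiply the two-term
    recursion at j by c (k - j) and sum over j: the symmetry between j and k - j
    replaces the factor j by k / 2, and a first-order recursion for the
    convolutions S k results, which c k.+2 satisfies too. *)
Lemma catalan_convolution (c : nat -> R) : c 0 = 1 -> c 1 = 0 ->
  (forall k, (k + 4)%:R * c k.+2 = 4 * k.+1%:R * c k) ->
  forall k, \sum_(j < k.+1) c j * c (k - j)%N = c k.+2.
Proof.
move=> c0 c1 rec; pose S k := \sum_(j < k.+1) c j * c (k - j)%N.
have rec' k : c k.+2 = (k + 4)%:R^-1 * (4 * k.+1%:R * c k).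
  by rewrite -rec mulKf// pnatr_eq0 addnS.
have half k : \sum_(j < k.+1) j%:R * (c j * c (k - j)%N) = k%:R / 2 * S k.
  set W := LHS; suff : W + W = k%:R * S k by move=> h; lra.
  rewrite {2}/W (reindex_inj rev_ord_inj)/= -big_split/= mulr_sumr.
  apply: eq_bigr => j _; rewrite subSS.
  have jk : (j <= k)%N by rewrite -ltnS.
  by rewrite subKn// natrB//; ring.
have Srec k : (k + 6)%:R / 2 * S k.+2 = 2 * (k + 2)%:R * S k + 2 * c k.+2.
  have h1 : \sum_(j < k.+1) (j + 4)%:R * c j.+2 * c (k - j)%N = 2 * (k + 2)%:R * S k.
    transitivity (\sum_(j < k.+1) 4 * (j%:R * (c j * c (k - j)%N) + c j * c (k - j)%N)).
      by apply: eq_bigr => j _; rewrite rec -natr1; ring.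
    by rewrite -mulr_sumr big_split/= half -/(S k) natrD; field.
  have h2 : \sum_(j < k.+3) (j%:R * (c j * c (k.+2 - j)%N) + 2 * (c j * c (k.+2 - j)%N)) =
     (k + 6)%:R / 2 * S k.+2.
    by rewrite big_split/= half -mulr_sumr -/(S k.+2) !natrD -!natr1; field.
  rewrite -h2 -h1 [LHS]big_ord_recl [in LHS]big_ord_recl/= /bump/= !add1n c0 c1 subn0.
  rewrite mul0r mul1r add0r mul0r mulr0 mulr0 addr0 add0r addrC; congr (_ + _).
  apply: eq_bigr => j _; rewrite !add1n !subSS.
  by rewrite natrD -!natr1; ring.
suff h k : S k = c k.+2 /\ S k.+1 = c k.+3 by move=> k; have [] := h k.
elim: k => [|k [IH1 IH2]].
  by rewrite /S !big_ord_recl !big_ord0/= /bump/= !rec' c0 c1; split; field.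
split => //.
have k60 : (k + 6)%:R != 0 :> R by rewrite pnatr_eq0 addnS.
apply: (@mulfI _ ((k + 6)%:R / 2)); first by rewrite mulf_neq0// invr_eq0 pnatr_eq0.
have h := rec k.+2; rewrite (_ : k.+2 + 4 = k + 6)%N in h; last by rewrite !addSn !addnS.
by rewrite Srec IH1 [RHS]mulrAC h natrD -!natr1; field.
Qed.

End catalan.

Section semicircle_moments.
Variable R : realType.
Notation mu := (@lebesgue_measure R).

Let s (x : R) := Num.sqrt (4 - x ^+ 2).

Let continuous_s : continuous s.
Proof.
move=> x.
apply: (continuous_comp (f := fun x : R => 4 - x ^+ 2)); last exact: sqrt_continuous.
by apply: cvgB; [exact: cvg_cst|exact: exprn_continuous].
Qed.

Let is_derive_s (x : R) : -2 < x < 2 -> is_derive x 1 s (- x / s x).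
Proof.
move=> x2; have h : 0 < 4 - x ^+ 2 by nra.
have -> : s = Num.sqrt \o (fun x => 4 - x ^+ 2) by [].
have d1 : is_derive x 1 (fun x : R => 4 - x ^+ 2) (- (2 * x)).
  have -> : (fun x : R => 4 - x ^+ 2) = cst 4 - (@id R) ^+ 2 by [].
  by apply: is_derive_eq; rewrite /= expr1 sub0r; congr (- _); exact: mulr1.
have d2 := is_derive1_sqrt h.
have h3 := @is_derive1_comp _ Num.sqrt (fun x => 4 - x ^+ 2) _ _ _ d2 d1.
apply: (is_derive_eq h3).
rewrite /= -/(s x); have s0 : s x != 0 by rewrite gt_eqF// sqrtr_gt0.
by rewrite /GRing.scale/=; field.
Qed.

Lemma semicircle_moment_integrable k :
  (@semicircle R : {measure set R -> \bar R}).-integrable setT (EFin \o (fun x => x ^+ k)) /\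
  \int[@semicircle R]_x x ^+ k = \int[mu]_(x in `[-2, 2]) (semicircle_pdf x * x ^+ k).
Proof.
have cpdf : continuous (@semicircle_pdf R).
  by move=> x; apply: cvgM; [exact: continuous_s|exact: cvg_cst].
refine (@Rintegral_density _ _ _ _ _ mu (semicircle R) idfun `[-2, 2]%classic
  (@semicircle_pdf R) _ _ _ _ _ (fun x => x ^+ k) _ _) => //.
- by move=> _ B mB; rewrite setTI.
- exact: continuous_measurable_fun.
- by move=> x; rewrite /semicircle_pdf divr_ge0// ?sqrtr_ge0// mulr_ge0// pi_ge0.
- apply: continuous_compact_integrable; first exact: segment_compact.
  apply: continuous_subspaceT => x; apply: cvgM; first exact: cpdf.
  exact: exprn_continuous.
Qed.

Definition semicircle_moment k : R := \int[@semicircle R]_x x ^+ k.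

Lemma semicircle_moment0 : semicircle_moment 0 = 1.
Proof.
rewrite /semicircle_moment; under eq_Rintegral do rewrite expr0.
rewrite Rintegral_cst// mul1r; have := @probability_setT _ _ R (@semicircle R).
by move=> /(congr1 fine).
Qed.

(** The derivative of x^k (4 - x^2)^(3/2), which vanishes at both ends of
    [-2, 2], is (4 k x^(k-1) - (k+3) x^(k+1)) (4 - x^2)^(1/2). *)
Lemma semicircle_moment_rec k :
  (k + 3)%:R * semicircle_moment k.+1 = 4 * k%:R * semicircle_moment k.-1.
Proof.
pose F (x : R) := (2 * pi)^-1 * (x ^+ k * s x ^+ 3).
pose f (x : R) := 4 * k%:R * (semicircle_pdf x * x ^+ k.-1) -
  (k + 3)%:R * (semicircle_pdf x * x ^+ k.+1).
have [i1 E1] := semicircle_moment_integrable k.-1.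
have [i2 E2] := semicircle_moment_integrable k.+1.
have cpdf (j : nat) : continuous (fun x : R => semicircle_pdf x * x ^+ j).
  move=> x; apply: cvgM; last exact: exprn_continuous.
  by apply: cvgM; [exact: continuous_s|exact: cvg_cst].
have cf : continuous f.
  by move=> x; apply: cvgB; apply: cvgM; [exact: cvg_cst|exact: cpdf|exact: cvg_cst|exact: cpdf].
have cF : continuous F.
  move=> x; apply: cvgM; first exact: cvg_cst.
  apply: cvgM; first exact: exprn_continuous.
  exact: (continuous_comp (@continuous_s x) (@exprn_continuous R 3 _)).
have s2 (x : R) : -2 < x < 2 -> s x ^+ 2 = 4 - x ^+ 2.
  by move=> x2; rewrite sqr_sqrtr//; nra.
have dF (x : R) : -2 < x < 2 -> is_derive x 1 F (f x).
  move=> x2; have ds := is_derive_s x2.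
  have s0 : s x != 0.
    by rewrite gt_eqF// sqrtr_gt0; nra.
  have pi0 : pi != 0 :> R by rewrite gt_eqF ?pi_gt0.
  have -> : F = (2 * pi)^-1 \*: ((@id R) ^+ k * s ^+ 3).
    by apply/funext => y; rewrite !fctE.
  apply: is_derive_eq; rewrite /GRing.scale/= mulr1 !fctE /= /f /semicircle_pdf -/(s x).
  have s4 := s2 _ x2.
  have -> : s x ^+ 3 = (4 - x ^+ 2) * s x by rewrite exprS mulrC s4.
  rewrite s4; have -> : 3%:R * (4 - x ^+ 2) * (- x / s x) = - 3 * x * s x.
    by rewrite -s4; field.
  move: (@pi R) pi0 => p p0.
  case: k {F f i1 E1 i2 E2 cf cF} => [|k].
    by rewrite !expr0 !mul0r expr1 add0n; field.
  have -> : (k.+1 + 3)%:R = k%:R + 4 :> R by rewrite natrD -(@natr1 R k); ring.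
  by rewrite -(@natr1 R k) !exprS/=; field.
have F0 (x : R) : x ^+ 2 = 4 -> F x = 0.
  by move=> x4; rewrite /F /s x4 subrr sqrtr0 expr0n/= mulr0 mulr0.
have : \int[mu]_(x in `[-2, 2]) f x = 0.
  rewrite /Rintegral (@continuous_FTC2 _ f F)//.
  - by rewrite !F0; [rewrite subee|ring|ring].
  - by lra.
  - exact: continuous_subspaceT.
  - split=> [x| |].
    + by rewrite in_itv/= => x2; have [] := dF x x2.
    + exact/cvg_at_right_filter/cF.
    + exact/cvg_at_left_filter/cF.
  - by move=> x; rewrite in_itv/= => x2; rewrite derive1E; have [_ ->] := dF x x2.
have ci (j : nat) : mu.-integrable `[-2, 2] (EFin \o (fun x : R => semicircle_pdf x * x ^+ j)).
  apply: continuous_compact_integrable; first exact: segment_compact.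
  exact: continuous_subspaceT.
have cZ (a : R) (j : nat) : mu.-integrable `[-2, 2]
    (EFin \o (fun x : R => a * (semicircle_pdf x * x ^+ j))).
  apply: continuous_compact_integrable; first exact: segment_compact.
  apply: continuous_subspaceT => x; apply: cvgM; [exact: cvg_cst|exact: cpdf].
rewrite /f RintegralB// !RintegralZl// -E1 -E2 => /eqP.
by rewrite subr_eq0 => /eqP ->.
Qed.

Lemma semicircle_moment1 : semicircle_moment 1 = 0.
Proof.
have := semicircle_moment_rec 0; rewrite mulr0 mul0r => /eqP.
by rewrite mulf_eq0 pnatr_eq0/= => /eqP.
Qed.

Lemma semicircle_moment_convolution k :
  semicircle_moment k.+2 =
  \sum_(j < k.+1) semicircle_moment j * semicircle_moment (k - j)%N.
Proof.
rewrite catalan_convolution//; [exact: semicircle_moment0|exact: semicircle_moment1|].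
by move=> j; have := semicircle_moment_rec j.+1; rewrite addSnnS.
Qed.

End semicircle_moments.

(** The factor 4 (m+1) / (m+4) of the moment recursion is at most 4. *)
Lemma semicircle_moment_le (R : realType) k :
  0 <= semicircle_moment R (2 * k) <= 2 ^+ (2 * k).
Proof.
elim: k => [|k /andP[IH1 IH2]]; first by rewrite muln0 semicircle_moment0 expr0 ler01 lexx.
have -> : (2 * k.+1 = (2 * k).+2)%N by lia.
set m := (2 * k)%N in IH1 IH2 *.
have h := semicircle_moment_rec R m.+1; rewrite /= in h.
have m40 : 0 < (m.+1 + 3)%:R :> R by rewrite ltr0n addSn.
have E : semicircle_moment R m.+2 = (m.+1 + 3)%:R^-1 * (4 * m.+1%:R * semicircle_moment R m).
  by rewrite -h mulKf// gt_eqF.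
apply/andP; split.
  by rewrite E !mulr_ge0// invr_ge0 ltW.
rewrite E ler_pdivrMl// !exprS.
have : m.+1%:R <= (m.+1 + 3)%:R :> R by rewrite ler_nat leq_addr.
have : 0 <= m.+1%:R :> R by [].
move: (m.+1%:R : R) ((m.+1 + 3)%:R : R) => u v u0 uv.
by have := ler_pM u0 IH1 uv IH2; lra.
Qed.

(** * The semicircle law *)

Theorem theorem5p5 (R : realType) (d : nat -> measure_display)
    (T : forall n : nat, measurableType (d n))
    (P : forall n : nat, probability (T n) R)
    (A : forall n : nat, random_symmx (T n) R n.+1)
    (A_GOE : forall n : nat, is_GOE (P n) (A n)) :
  weak_cvg (fun n : nat => averaged_esd (P n) (A n)) (semicircle R).
Proof.
have lim L : (fun n => mean_traces (P n) (A n) L) @ \oo -->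
    \prod_(k <- L) semicircle_moment R k.
  apply: (loop_equation_limit (e := fun n => mean_traces (P n) (A n))).
  - by move=> n; exact: mean_traces_nil.
  - by move=> n l; exact: mean_traces0.
  - by move=> n k l; exact: mean_traces_loop.
  - exact: semicircle_moment0.
  - case=> [|k]; last exact: semicircle_moment_convolution.
    by rewrite big_ord0 semicircle_moment1.
apply: weak_cvg_real => f M cf fM.
apply: (cvg_moments_bounded_continuous (b := 2) _ _ _ _ _ cf fM) => //.
- by move=> n k; have [] := averaged_esd_moment (A_GOE n) k.
- by move=> k; have [] := semicircle_moment_integrable R k.
- by move=> k; have /andP[] := semicircle_moment_le R k.
- move=> k; have := lim [:: k]; rewrite big_seq1; apply: cvg_trans.
  apply: near_eq_cvg; apply: nearW => n.
  by have [_] := averaged_esd_moment (A_GOE n) k.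
Qed.
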